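(* For any $0\le \ell\le j-1$ there exists a constant $C_\ell>0$ (independent of $n$ and $i$) such that for all $i\le i_1$, with probability at least $1-\exp(-\Theta(n^{\delta/2}))$ we have $$\Delta_\ell(\partial(i))\le C_\ell\left(\frac{|\partial(i)|}{n^\ell}+n^\delta\right).$$
   Context: Setting: $k\ge 2$ and $1\le j\le k-1$ are fixed integers, $0<\delta<1/6$ is a fixed constant, and $\varepsilon=\varepsilon(n)$, $\lambda=\lambda(n)$ are positive functions with $n^{-1/2+\delta/2}\ll\lambda\ll\varepsilon\ll 1$ and $n^{-j/3}\ll\lambda$, where $f\ll g$ means $f=o(g)$ as $n\to\infty$. Let $p=(1+\varepsilon)\frac{1}{\binom kj-1}\frac{1}{\binom{n}{k-j}}$, and let $\mathcal H^k(n,p)$ be the random $k$-uniform hypergraph on $[n]$ in which each $k$-subset is an edge independently with probability $p$. Breadth-first search: given fixed arbitrary orderings of the $j$-sets and of the $k$-sets of vertices and a fixed $j$-set $J_1$, the process BFS explores the component of $J_1$ as follows. Initially $J_1$ is active and all other $j$-sets are neutral; generation $1$ is $\partial(1)=\{J_1\}$. Generation $\partial(i+1)$ is produced from $\partial(i)$ thus: for each $j$-set $J\in\partial(i)$ in order, query (in order) all previously unqueried $k$-sets containing $J$; whenever a queried $k$-set is an edge of $\mathcal H^k(n,p)$, all neutral $j$-sets contained in it are added to $\partial(i+1)$ and become discovered (no longer neutral). Stopping conditions, checked at the beginning of round $i$: (S1) $\partial(i)=\emptyset$; (S2) $|\partial(1)\cup\dots\cup\partial(i)|\ge\lambda n^j$;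 (S3) $|\partial(i)|\ge\lambda^2n^j$. The random time $i_1$ is the smallest $i\in\mathbb N$ for which at least one of (S1), (S2), (S3) holds. For a collection $\mathcal J$ of $j$-sets and a set $L$ of $\ell$ vertices, $d_L(\mathcal J)$ is the number of $j$-sets in $\mathcal J$ containing $L$, and $\Delta_\ell(\mathcal J)=\max_L d_L(\mathcal J)$ over all $\ell$-subsets $L$ of $[n]$ (so $\Delta_0(\mathcal J)=|\mathcal J|$). ''Probability at least $1-\exp(-\Theta(f(n)))$'' means at least $1-\exp(-cf(n))$ for some constant $c>0$ and all large $n$. Since $i_1$ is random, ''for $i\le i_1$, with probability at least $1-q$ an assertion about $i$ holds'' means that the probability that $i\le i_1$ and the assertion fails is at most $q$. *)

(* Defs.v *)
From mathcomp Require Import all_boot all_order all_algebra.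
From mathcomp Require Import reals.

Set Implicit Arguments.
Unset Strict Implicit.
Unset Printing Implicit Defensive.

Import Order.TTheory GRing.Theory Num.Theory.

Local Open Scope ring_scope.

Definition rsets (n r : nat) : {set {set 'I_n}} :=
  [set A : {set 'I_n} | #|A| == r].

Definition edge_prob (R : realType) (k j n : nat) (e : R) : R :=
  (1 + e) * ('C(k, j)%:R - 1)^-1 * ('C(n, k - j)%:R)^-1.

(* A k-uniform hypergraph on 'I_n is identified with its edge set, a subset of
   [rsets n k]; this is the probability of the event E under the product law. *)
Definition hgprob (R : realType) (n k : nat) (p : R)
    (E : pred {set {set 'I_n}}) : R :=
  \sum_(H in powerset (rsets n k) | E H)
    \prod_(K in rsets n k) (if K \in H then p else 1 - p).

(* The neutral j-sets are those outside [discovered].  While generation i.+1 is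
   being produced, [next_gen] holds the part of it found so far. *)
Record bfs_state (n : nat) := BfsState {
  queried : {set {set 'I_n}};
  discovered : {set {set 'I_n}};
  next_gen : {set {set 'I_n}} }.

Definition query (n j : nat) (H : {set {set 'I_n}}) (st : bfs_state n)
    (K : {set 'I_n}) : bfs_state n :=
  let new := if K \in H
    then [set J in rsets n j | (J \subset K) && (J \notin discovered st)]
    else set0 in
  BfsState (K |: queried st) (discovered st :|: new) (next_gen st :|: new).

(* The orderings of the j-sets and of the k-sets are given by their increasing
   enumerations sJ and sK. *)
Definition explore (n j : nat) (sK : seq {set 'I_n}) (H : {set {set 'I_n}})
    (st : bfs_state n) (J : {set 'I_n}) : bfs_state n :=
  foldl (query j H) st
    [seq K : {set 'I_n} <- sK | (J \subset K) && (K \notin queried st)].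

Definition bfs_round (n j : nat) (sJ sK : seq {set 'I_n})
    (H : {set {set 'I_n}}) (st : bfs_state n) : bfs_state n :=
  foldl (explore j sK H) (BfsState (queried st) (discovered st) set0)
    [seq J : {set 'I_n} <- sJ | J \in next_gen st].

Definition bfs_init (n : nat) (J1 : {set 'I_n}) : bfs_state n :=
  BfsState set0 [set J1] [set J1].

(* Generations are numbered from 1; the value at i = 0 is irrelevant. *)
Definition generation (n j : nat) (sJ sK : seq {set 'I_n}) (J1 : {set 'I_n})
    (H : {set {set 'I_n}}) (i : nat) : {set {set 'I_n}} :=
  next_gen (iter i.-1 (bfs_round j sJ sK H) (bfs_init J1)).

Definition bfs_stop (R : realType) (n j : nat) (lam : R)
    (sJ sK : seq {set 'I_n}) (J1 : {set 'I_n}) (H : {set {set 'I_n}})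
    (i : nat) : bool :=
  let gen := generation j sJ sK J1 H in
  [|| gen i == set0,
      lam * n%:R ^+ j <= #|\bigcup_(1 <= s < i.+1) gen s|%:R
    | lam ^+ 2 * n%:R ^+ j <= #|gen i|%:R].

Definition bfs_inv (n : nat) (D : {set {set 'I_n}}) (st : bfs_state n) : bool :=
  (D :|: next_gen st \subset discovered st) && [disjoint D & next_gen st].

Lemma bfs_inv_query (n j : nat) (H D : {set {set 'I_n}}) (st : bfs_state n)
    (K : {set 'I_n}) : bfs_inv D st -> bfs_inv D (query j H st K).
Proof.
case/andP; rewrite subUset => /andP[sD sN] dDN.
have dD : [disjoint D & [set J in rsets n j |
    (J \subset K) && (J \notin discovered st)]].
  rewrite disjoint_subset; apply/subsetP => J /(subsetP sD) JD.
  by rewrite !inE JD /= !andbF.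
rewrite /bfs_inv /query /=; case: ifP => _; last by rewrite !setU0 subUset sD sN.
rewrite setUA setSU ?subUset ?sD ?sN //=.
by rewrite -setI_eq0 setIUr setU_eq0 !setI_eq0 dDN dD.
Qed.

Lemma bfs_inv_round (n j : nat) (sJ sK : seq {set 'I_n})
    (H : {set {set 'I_n}}) (st : bfs_state n) :
  bfs_inv (discovered st) (bfs_round j sJ sK H st).
Proof.
rewrite /bfs_round; set D := discovered st.
have : bfs_inv D (BfsState (queried st) D set0).
  by rewrite /bfs_inv /= setU0 subxx -setI_eq0 setI0 eqxx.
elim: [seq J <- sJ | _] (BfsState _ _ _) => //= J s IH st' inv'.
apply: IH; rewrite /explore.
move: [seq K <- sK | _] => s'.
elim: s' st' inv' => //= K s' IH st' inv'.
exact/IH/bfs_inv_query.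
Qed.

Lemma bfs_stop_ex (R : realType) (n j : nat) (lam : R)
    (sJ sK : seq {set 'I_n}) (J1 : {set 'I_n}) (H : {set {set 'I_n}}) :
  exists i, (0 < i)%N && bfs_stop j lam sJ sK J1 H i.
Proof.
pose M := #|{set 'I_n}|.
case: (boolP [exists i : 'I_M, generation j sJ sK J1 H i.+2 == set0]).
  by case/existsP=> i gi0; exists i.+2; rewrite /bfs_stop gi0.
rewrite negb_exists => /forallP gn0.
pose st i := iter i (bfs_round j sJ sK H) (bfs_init J1).
have grow i : (i <= M)%N -> (i < #|discovered (st i)|)%N.
  elim: i => [|i IH] iM; first by rewrite cards1.
  have /andP[sub dis] := bfs_inv_round j sJ sK H (st i).
  apply: (leq_ltn_trans (IH (ltnW iM))); rewrite -/(st i.+1).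
  apply: leq_trans (subset_leq_card sub).
  rewrite cardsU (disjoint_setI0 dis) cards0 subn0 -addn1 leq_add2l card_gt0.
  exact: (gn0 (Ordinal iM)).
by have := grow M (leqnn _); rewrite ltnNge max_card.
Qed.

Definition bfs_stop_time (R : realType) (n j : nat) (lam : R)
    (sJ sK : seq {set 'I_n}) (J1 : {set 'I_n}) (H : {set {set 'I_n}}) : nat :=
  ex_minn (bfs_stop_ex j lam sJ sK J1 H).

Definition set_degree (n : nat) (L : {set 'I_n}) (F : {set {set 'I_n}}) : nat :=
  #|[set J in F | L \subset J]|.

Definition max_degree (n l : nat) (F : {set {set 'I_n}}) : nat :=
  \max_(L in rsets n l) set_degree L F.

(* Main.v *)
Require Import Defs.
From mathcomp Require Import all_boot all_order all_algebra.
From mathcomp Require Import all_classical all_reals all_analysis.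
From mathcomp Require Import ring lra.
(* Last, so that names such as set0 and setU refer to finite sets. *)
From mathcomp Require Import fintype finset.

(** Fix a set [L] of [l] vertices and follow the number [d_L] of [j]-sets above [L]
    from one generation to the next. A [j]-set above [L] is discovered through an
    edge [K] that was queried from some [j]-set of the current generation. Either
    [K] contains a [j]-set of this generation above [L] (a pivot), or it does not
    (a jump).

    Pivots contract. A [j]-set lies in about ['C(n, k - j)] [k]-sets, and the edge
    probability is [(1 + eps) / (('C(k, j) - 1) * 'C(n, k - j))]; an edge found from
    a set above [L] yields at most ['C(k - l, j - l) - 1] further sets above [L].
    For [l > 0] this is less than ['C(k, j) - 1], so that the expected number of
    sets above [L] obtained through pivots is at most a constant factor below 1
    times [d_L].

    Jumps are rare. A jump joins [L] to a [j]-set [J] with [J :&: L = I] for a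
    proper subset [I] of [L], and [J :|: L] has [l - #|I|] vertices more than [J].
    So the [j]-sets above [I] contribute at most about [d_I / n ^ (l - #|I|)] edges in
    expectation, and [d_I] is controlled by induction on [l].

    The expectations are replaced by the numbers themselves with a Chernoff bound
    for adaptive sampling ([strategy_tail]): if [N] counts the queries of some
    predictable kind, and [X] the edges among them, then
    [a * X - p * (expR a - 1) * N < S] fails with probability at most [expR (- S)],
    whatever the random number [N] is. With [S = n `^ (delta / 2)] there is room for
    a union over polynomially many kinds. This gives [window_recursion], a linear
    recursion for the degrees, summed over any window of rounds.

    The recursion is used twice. For the window of all rounds so far it becomes an
    inequality with the degree of [L] in the whole discovered set on both sides, and
    the contraction solves it: the discovered [j]-sets are evenly spread
    ([reach_degree]). As the search has not been stopped they are also few, so a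
    typical [k]-set queried contains no second discovered [j]-set, and a generation
    has almost the size of its predecessor ([front_growth]). For the window of a
    single round the contraction then beats this small possible loss in
    [#|gen i|], and the bound propagates from round to round
    ([front_degree_bound]).

    Since all generations before the stopping time are nonempty and disjoint, there
    are at most [n ^ j] rounds ([rounds_le]), so the union bound is indeed over
    polynomially many events ([generation_tail]). *)

Set Implicit Arguments.
Unset Strict Implicit.
Unset Printing Implicit Defensive.

Import Order.TTheory GRing.Theory Num.Theory.
Import numFieldNormedType.Exports.
Local Open Scope ring_scope.

(** * Adaptive exposure of a random set *)

Definition expect (R : realType) (T : finType) (p : R) (U : {set T})
    (f : {set T} -> R) : R :=
  \sum_(H in powerset U) (\prod_(K in U) (if K \in H then p else 1 - p)) * f H.

Lemma expect_split (R : realType) (T : finType) (p : R) (U : {set T})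
    (f : {set T} -> R) (K : T) : K \in U ->
  expect p U f = p * expect p (U :\ K) (fun H => f (K |: H))
                 + (1 - p) * expect p (U :\ K) f.
Proof.
move=> KU; rewrite /expect (bigID (fun H : {set T} => K \in H)) /=; congr (_ + _).
  rewrite mulr_sumr (reindex_onto (fun H => K |: H) (fun H => H :\ K)) /=; last first.
    by move=> H /andP[_ KH]; rewrite setD1K.
  apply: eq_big => [H|H].
    rewrite !powersetE subUset sub1set KU setU11 andbT /= subsetD1.
    apply/andP/andP => [[HU /eqP <-]|[HU KH]]; last by rewrite setU1K ?eqxx.
    by rewrite !inE eqxx /=; split=> //;
      apply: subset_trans (subsetDl _ _) _; rewrite subUset sub1set KU HU.
  rewrite powersetE => /andP[/andP[HU _] /eqP eH].
  rewrite mulrA; congr (_ * _); rewrite (big_setD1 K) //= setU11; congr (_ * _).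
  apply: eq_bigr => K'; rewrite !inE => /andP[/negPf -> _]; by rewrite orFb.
rewrite mulr_sumr; apply: eq_big => [H|H]; first by rewrite !powersetE subsetD1.
rewrite powersetE => /andP[HU /negPf KH].
by rewrite mulrA; congr (_ * _); rewrite (big_setD1 K) //= KH.
Qed.

Lemma expect_const (R : realType) (T : finType) (p c : R) (U : {set T}) :
  expect p U (fun=> c) = c.
Proof.
move: {2}#|U| (erefl #|U|) => m; elim: m U => [|m IH] U cU.
  move/eqP: cU; rewrite cards_eq0 => /eqP ->.
  by rewrite /expect powerset0 big_set1 big_set0 mul1r.
have /card_gt0P[K KU] : (0 < #|U|)%N by rewrite cU.
have cK : #|U :\ K| = m by apply: succn_inj; rewrite -cU (cardsD1 K U) KU.
by rewrite (expect_split _ _ KU) !IH //; ring.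
Qed.

Lemma expect_weight_ge0 (R : realType) (T : finType) (p : R) (U H : {set T}) :
  0 <= p <= 1 -> 0 <= \prod_(K in U) (if K \in H then p else 1 - p).
Proof.
move=> /andP[p0 p1]; apply: prodr_ge0 => K _; case: ifP => _ //.
by rewrite subr_ge0.
Qed.

(** A decision tree that reveals a random subset element by element: [Query K m t1 t0]
    asks for [K] and goes on with [t1] if it is present, with [t0] if not; [m] tells
    whether this query is counted. Fixing [m] before the answer is what makes the
    choice of the counted queries predictable. *)
Inductive strategy (T : Type) :=
  Halt | Query of T & bool & strategy T & strategy T.
Arguments Halt {T}.

Fixpoint asked (T : finType) (t : strategy T) (H : {set T}) : nat :=
  if t is Query K m t1 t0 then (m + asked (if K \in H then t1 else t0) H)%N
  else 0.

Fixpoint found (T : finType) (t : strategy T) (H : {set T}) : nat :=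
  if t is Query K m t1 t0
  then ((m && (K \in H)) + found (if K \in H then t1 else t0) H)%N else 0.

(** No element is asked for twice, hence each answer is independent of the past. *)
Fixpoint fresh (T : finType) (U : {set T}) (t : strategy T) : bool :=
  if t is Query K _ t1 t0
  then [&& K \in U, fresh (U :\ K) t1 & fresh (U :\ K) t0] else true.

Lemma fresh_sub (T : finType) (t : strategy T) (U V : {set T}) :
  U \subset V -> fresh U t -> fresh V t.
Proof.
elim: t U V => //= K _ t1 IH1 t0 IH0 U V sUV /and3P[KU f1 f0].
by rewrite (subsetP sUV) //= (IH1 _ _ _ f1) ?(IH0 _ _ _ f0) ?setSD.
Qed.

Lemma fresh_indep (T : finType) (t : strategy T) (U H : {set T}) (K : T) :
  fresh U t -> K \notin U ->
  asked t (K |: H) = asked t H /\ found t (K |: H) = found t H.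
Proof.
elim: t U => //= K' m t1 IH1 t0 IH0 U /and3P[KU f1 f0] nKU.
have nK : K \notin U :\ K' by rewrite !inE negb_and nKU orbT.
have -> : (K' \in K |: H) = (K' \in H).
  by rewrite !inE; case: eqP KU nKU => // -> ->.
by case: ifP => _; [case: (IH1 _ f1 nK)|case: (IH0 _ f0 nK)] => -> ->.
Qed.

(** The exponential supermartingale: one counted query multiplies the expectation
    by [(1 + p (e^a - 1)) exp (- p (e^a - 1))], which is at most 1, and the
    answers to later queries are independent of it. *)
Lemma expect_strategy (R : realType) (T : finType) (p a : R) (U : {set T})
    (t : strategy T) : 0 <= p <= 1 -> fresh U t ->
  expect p U (fun H => expR (a * (found t H)%:R
                             - p * (expR a - 1) * (asked t H)%:R)) <= 1.
Proof.
move=> p01; have /andP[p0 p1] := p01.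
elim: t U => [|K m t1 IH1 t0 IH0] U /=.
  by move=> _; rewrite !mulr0 subr0 expR0 expect_const.
move=> /and3P[KU f1 f0].
have nK : K \notin U :\ K by rewrite !inE eqxx.
set th := expR a - 1.
pose w (b : bool) := expR (a * (m && b)%:R - p * th * m%:R).
rewrite (expect_split _ _ KU).
have e1 : expect p (U :\ K) (fun H => expR
    (a * ((m && (K \in K |: H)) + found (if K \in K |: H then t1 else t0) (K |: H))%:R
     - p * th * (m + asked (if K \in K |: H then t1 else t0) (K |: H))%:R))
    <= w true.
  rewrite -[leRHS]mulr1; apply: le_trans (ler_wpM2l (expR_ge0 _) (IH1 _ f1)).
  rewrite /expect mulr_sumr; apply: ler_sum => H _.
  rewrite setU11; have [-> ->] := fresh_indep H f1 nK.
  rewrite [leRHS]mulrCA; apply: ler_wpM2l; first exact: expect_weight_ge0.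
  rewrite /w -expRD ler_expR !natrD; rewrite -/th; lra.
have e0 : expect p (U :\ K) (fun H => expR
    (a * ((m && (K \in H)) + found (if K \in H then t1 else t0) H)%:R
     - p * th * (m + asked (if K \in H then t1 else t0) H)%:R))
    <= w false.
  rewrite -[leRHS]mulr1; apply: le_trans (ler_wpM2l (expR_ge0 _) (IH0 _ f0)).
  rewrite /expect mulr_sumr; apply: ler_sum => H.
  rewrite powersetE subsetD1 => /andP[_ /negPf ->].
  rewrite [leRHS]mulrCA; apply: ler_wpM2l; first exact: expect_weight_ge0.
  rewrite /w -expRD ler_expR !natrD; rewrite -/th; lra.
apply: (@le_trans _ _ (p * w true + (1 - p) * w false)).
  by apply: lerD; apply: ler_wpM2l => //; rewrite subr_ge0.
rewrite /w andbT andbF mulr0 sub0r.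
case: m {e1 e0 w}; last by rewrite !mulr0 subrr oppr0 expR0; lra.
rewrite !mulr1 expRD.
have -> : p * (expR a * expR (- (p * th))) + (1 - p) * expR (- (p * th))
        = (1 + p * th) * expR (- (p * th)) by rewrite /th; ring.
rewrite -[leRHS](mulrV (unitf_gt0 (expR_gt0 (p * th)))) -expRN.
by apply: ler_wpM2r; rewrite ?expR_ge0 ?expR_ge1Dx.
Qed.

Lemma hgprobE (R : realType) (n k : nat) (p : R) (E : pred {set {set 'I_n}}) :
  hgprob k p E = expect p (rsets n k) (fun H => (E H)%:R).
Proof.
rewrite /hgprob /expect big_mkcondr /=; apply: eq_bigr => H _.
by case: (E H); rewrite ?mulr1 ?mulr0.
Qed.

(** Chernoff's bound with a random, adaptively chosen number of trials: it is
    Markov's inequality for [expect_strategy], and its two tails are the two signs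
    of [a]. *)
Lemma strategy_tail (R : realType) (n k : nat) (p a s : R)
    (t : strategy {set 'I_n}) : 0 <= p <= 1 -> fresh (rsets n k) t ->
  hgprob k p (fun H => s <= a * (found t H)%:R
                            - p * (expR a - 1) * (asked t H)%:R) <= expR (- s).
Proof.
move=> p01 ft; rewrite hgprobE -[leRHS]mulr1.
apply: le_trans (ler_wpM2l (expR_ge0 _) (expect_strategy a p01 ft)).
rewrite /expect mulr_sumr; apply: ler_sum => H _.
rewrite mulrCA; apply: ler_wpM2l; first exact: expect_weight_ge0.
case: (boolP (s <= _)) => [h|_] /=; last by rewrite mulr_ge0 ?expR_ge0.
rewrite -expRD -[leLHS]expR0 ler_expR; lra.
Qed.

Lemma hgprob_union (R : realType) (n k : nat) (p q : R) (I : finType)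
    (X : {set I}) (E : pred {set {set 'I_n}}) (B : I -> pred {set {set 'I_n}}) :
  0 <= p <= 1 ->
  (forall H : {set {set 'I_n}}, H \subset rsets n k -> E H ->
     exists2 x, x \in X & B x H) ->
  (forall x, x \in X -> hgprob k p (B x) <= q) ->
  hgprob k p E <= #|X|%:R * q.
Proof.
move=> p01 EB Bq; have /andP[p0 p1] := p01.
apply: (@le_trans _ _ (\sum_(x in X) hgprob k p (B x))); last first.
  by rewrite mulr_natl -sumr_const; apply: ler_sum => x /Bq.
rewrite hgprobE; under eq_bigr do rewrite hgprobE.
rewrite /expect exchange_big /=; apply: ler_sum => H; rewrite powersetE => HU.
rewrite -mulr_sumr; apply: ler_wpM2l; first exact: expect_weight_ge0.
case: (boolP (E H)) => [/(EB _ HU)[x xX Bx]|_]; last by apply: sumr_ge0.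
by rewrite (bigD1 x) //= Bx lerDl sumr_ge0.
Qed.

(** * The search as a closure operator *)

Definition spread (n k j : nat) (H D : {set {set 'I_n}}) : {set {set 'I_n}} :=
  [set J in rsets n j | [exists K in H :&: rsets n k,
     (J \subset K) && [exists J' in D, J' \subset K]]].

(** The union of the first [r] generations, free of the orderings and of the record
    of queries; [reach 0] is empty so that differences of consecutive values are
    the generations, the first one included. *)
Definition reach (n k j : nat) (H : {set {set 'I_n}}) (J1 : {set 'I_n})
    (r : nat) : {set {set 'I_n}} :=
  if r is s.+1 then iter s (fun G => G :|: spread k j H G) [set J1] else set0.

Lemma spreadP (n k j : nat) (H D : {set {set 'I_n}}) (J : {set 'I_n}) :
  reflect (#|J| = j /\ exists K J', [/\ K \in H, #|K| = k, J \subset K, J' \in D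
             & J' \subset K]) (J \in spread k j H D).
Proof.
rewrite !inE; apply: (iffP andP) => [[/eqP cJ /existsP[K]]|[-> [K [J' []]]]].
  rewrite !inE => /andP[/andP[KH /eqP cK] /andP[JK /existsP[J' /andP[J'D J'K]]]].
  by split=> //; exists K, J'.
move=> KH cK JK J'D J'K; split=> //; apply/existsP; exists K.
by rewrite !inE KH cK JK eqxx /=; apply/existsP; exists J'; rewrite J'D J'K.
Qed.

Lemma mem_rsets (n r : nat) (A : {set 'I_n}) : (A \in rsets n r) = (#|A| == r).
Proof. by rewrite inE. Qed.

Section BfsAsReach.
Variables (n k j : nat) (H : {set {set 'I_n}}).

Let covered (s : seq {set 'I_n}) : {set {set 'I_n}} :=
  [set J in rsets n j | has (fun K => (K \in H) && (J \subset K)) s].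

Lemma foldl_query (s : seq {set 'I_n}) (st : bfs_state n) :
  let st' := foldl (query j H) st s in
  [/\ queried st' = queried st :|: [set K in s],
      discovered st' = discovered st :|: covered s
    & next_gen st' = next_gen st :|: (covered s :\: discovered st)].
Proof.
elim: s st => [|K s IH] st /=.
  by split; apply/setP => J; rewrite !inE ?andbF ?orbF.
have [-> -> ->] := IH (query j H st K); rewrite /query /=.
split; apply/setP => J; rewrite !inE //=; first by case: (J == K); rewrite ?orbT.
  case: ifP => _; rewrite !inE /=; last by rewrite !orbF.
  by case: (J \in discovered st) => //=; rewrite andbT; case: (#|J| == j).
case: ifP => _; rewrite !inE /= ?orbF //.
by case: (J \in discovered st) => //=; case: (#|J| == j) => //=;
  case: (J \in next_gen st) => //=; case: (J \subset K).
Qed.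

(** An edge that was queried has no neutral [j]-set left. This is why a repeated
   query would not change the search, and why the record of queries can be
   forgotten. *)
Let closed_state (st : bfs_state n) : Prop :=
  forall K J : {set 'I_n}, K \in queried st -> K \in H -> J \subset K ->
    #|J| = j -> J \in discovered st.

Variable sK : seq {set 'I_n}.
Hypothesis sK_perm : perm_eq sK (enum (rsets n k)).

Lemma foldl_explore (s : seq {set 'I_n}) (st : bfs_state n) :
  closed_state st ->
  let st' := foldl (explore j sK H) st s in
  [/\ closed_state st',
      discovered st' = discovered st :|: spread k j H [set J in s]
    & next_gen st' = next_gen st
                     :|: (spread k j H [set J in s] :\: discovered st)].
Proof.
have sub_sK K : (K \in sK) = (#|K| == k).
  by rewrite (perm_mem sK_perm) mem_enum mem_rsets.
elim: s st => [|J0 s IH] st cl /=.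
  have -> : spread k j H [set J in [::]] = set0.
    apply/setP => J; rewrite [RHS]inE; apply/negbTE/negP => /spreadP[_ [K [J' []]]].
    by rewrite inE.
  by split=> //; rewrite ?set0D ?setU0.
pose s0 := [seq K : {set 'I_n} <- sK | (J0 \subset K) && (K \notin queried st)].
have [eQ eD eN] := foldl_query s0 st.
have disc_or J : (J \in discovered st) || (J \in covered s0)
               = (J \in discovered st) || (J \in spread k j H [set J0]).
  case: (boolP (J \in discovered st)) => //= nJ; apply/idP/spreadP.
    rewrite !inE => /andP[/eqP cJ /hasP[K]].
    rewrite mem_filter sub_sK => /andP[/andP[J0K _] /eqP cK] /andP[KH JK].
    by split=> //; exists K, J0; rewrite inE.
  move=> [cJ [K [J' [KH cK JK]]]]; rewrite inE => /eqP -> J0K.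
  rewrite !inE cJ eqxx; apply/hasP; exists K; last by rewrite KH.
  rewrite mem_filter J0K sub_sK cK eqxx andbT /=.
  by apply: contra nJ => KQ; apply: (cl K).
have eD' : discovered (explore j sK H st J0)
         = discovered st :|: spread k j H [set J0].
  by rewrite /explore eD; apply/setP => J; rewrite !in_setU disc_or.
have eN' : next_gen (explore j sK H st J0)
         = next_gen st :|: (spread k j H [set J0] :\: discovered st).
  rewrite /explore eN; apply/setP => J; rewrite !in_setU !in_setD; congr (_ || _).
  by have := disc_or J; case: (J \in discovered st).
have cl' : closed_state (explore j sK H st J0).
  move=> K J; rewrite /explore eQ eD in_setU => /orP[KQ|].
    by move=> KH JK cJ; rewrite in_setU (cl K).
  rewrite inE => Ks KH JK cJ; rewrite !inE cJ eqxx; apply/orP; right.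
  by apply/hasP; exists K; rewrite ?KH.
have [cl2 eD2 eN2] := IH _ cl'.
have spreadU J : (J \in spread k j H [set J in J0 :: s])
  = (J \in spread k j H [set J0]) || (J \in spread k j H [set J in s]).
  apply/spreadP/orP => [[cJ [K [J' [KH cK JK J's]]]]|]; first move: J's.
    rewrite 2!inE => /orP[/eqP ->|J's] J'K; [left|right]; apply/spreadP.
      by split=> //; exists K, J0; rewrite inE.
    by split=> //; exists K, J'; rewrite inE.
  case=> /spreadP[cJ [K [J' [KH cK JK J'D J'K]]]]; split=> //; exists K, J'.
    by split=> //; move: J'D; rewrite !inE => ->.
  by split=> //; move: J'D; rewrite !inE => ->; rewrite orbT.
split=> //; apply/setP => J.
  by rewrite eD2 eD' !in_setU spreadU orbA.
rewrite eN2 eN' eD' !(in_setU, in_setD) spreadU.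
by case: (J \in discovered st) => //=; case: (J \in spread k j H [set J0]);
  rewrite ?orbT ?orbF ?andbF.
Qed.

Lemma reach_sub (J1 : {set 'I_n}) (r : nat) :
  reach k j H J1 r \subset reach k j H J1 r.+1.
Proof. by case: r => [|r]; rewrite ?sub0set //= subsetUl. Qed.

Lemma reach_mono (J1 : {set 'I_n}) (r s : nat) : (r <= s)%N ->
  reach k j H J1 r \subset reach k j H J1 s.
Proof.
move=> /subnK <-; elim: (s - r)%N => // d IH.
exact: subset_trans IH (reach_sub _ _).
Qed.

Lemma spread_reach (J1 : {set 'I_n}) (r : nat) :
  spread k j H (reach k j H J1 r) \subset reach k j H J1 r.+1.
Proof.
case: r => [|r]; last by rewrite /= subsetUr.
by apply/subsetP => J /spreadP[_ [K [J' []]]]; rewrite inE.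
Qed.

Lemma reachSE (J1 : {set 'I_n}) (r : nat) :
  reach k j H J1 r.+2 = reach k j H J1 r.+1
    :|: spread k j H (reach k j H J1 r.+1 :\: reach k j H J1 r).
Proof.
apply/eqP; rewrite eqEsubset; apply/andP; split; last first.
  rewrite subUset reach_sub; apply: subset_trans (spread_reach _ _).
  apply/subsetP => J /spreadP[cJ [K [J' [KH cK JK]]]]; rewrite inE => /andP[_ J'D] J'K.
  by apply/spreadP; split=> //; exists K, J'.
have {1}-> : reach k j H J1 r.+2
  = reach k j H J1 r.+1 :|: spread k j H (reach k j H J1 r.+1) by [].
rewrite subUset subsetUl /=.
apply/subsetP => J /spreadP[cJ [K [J' [KH cK JK J'D J'K]]]]; rewrite in_setU.
case: (boolP (J' \in reach k j H J1 r)) => J'r.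
  apply/orP; left; apply: (subsetP (spread_reach _ _)).
  by apply/spreadP; split=> //; exists K, J'.
apply/orP; right; apply/spreadP; split=> //; exists K, J'; split=> //.
by rewrite inE J'r.
Qed.

Variable sJ : seq {set 'I_n}.
Hypothesis sJ_perm : perm_eq sJ (enum (rsets n j)).
Variable J1 : {set 'I_n}.
Hypothesis J1_card : J1 \in rsets n j.

Lemma reach_rsets (r : nat) : reach k j H J1 r \subset rsets n j.
Proof.
case: r => [|r]; first exact: sub0set.
elim: r => [|r IH] /=; first by rewrite sub1set.
by rewrite subUset IH; apply/subsetP => J /spreadP[/eqP cJ _]; rewrite mem_rsets.
Qed.

(** Edges met by an earlier generation have been closed up, so a new round only adds
    what the last generation sees. *)
Lemma generation_reach (i : nat) :
  generation j sJ sK J1 H i.+1 = reach k j H J1 i.+1 :\: reach k j H J1 i.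
Proof.
rewrite /generation /=.
set st := iter i _ _.
suff [] : [/\ closed_state st, discovered st = reach k j H J1 i.+1
     & next_gen st = reach k j H J1 i.+1 :\: reach k j H J1 i] by [].
rewrite {}/st; elim: i => [|i [cl eD eN]].
  by split; rewrite /= ?setD0 // => K J; rewrite inE.
rewrite iterS; set st := iter i _ _ in cl eD eN *.
have cl' : closed_state (BfsState (queried st) (discovered st) set0) by exact: cl.
rewrite /bfs_round; have [cl2 -> ->] :=
  foldl_explore [seq J <- sJ | J \in next_gen st] cl'.
have -> : [set J in [seq J <- sJ | J \in next_gen st]]
    = reach k j H J1 i.+1 :\: reach k j H J1 i.
  rewrite -eN; apply/setP => J; rewrite inE mem_filter (perm_mem sJ_perm) mem_enum.
  rewrite andb_idr // eN inE => /andP[_]; exact/subsetP/reach_rsets.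
rewrite [discovered (BfsState _ _ _)]/= [next_gen (BfsState _ _ _)]/= eD set0U.
split; first by move: cl2; rewrite eD.
  by rewrite reachSE.
by rewrite reachSE setDUl setDv set0U.
Qed.

End BfsAsReach.

(** * Counting extensions *)

Lemma card_bigcup_leq (I T : finType) (P : pred I) (F : I -> {set T}) :
  (#|\bigcup_(i | P i) F i| <= \sum_(i | P i) #|F i|)%N.
Proof.
apply: (big_rec2 (fun (S : {set T}) m => #|S| <= m)%N); first by rewrite cards0.
move=> i m S _ le; apply: leq_trans (leq_of_leqif (leq_card_setU _ _)) _.
by rewrite leq_add2l.
Qed.

Lemma card_between (n r : nat) (L K : {set 'I_n}) :
  L \subset K -> (#|L| <= r)%N ->
  #|[set J in rsets n r | (L \subset J) && (J \subset K)]|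
    = 'C(#|K| - #|L|, r - #|L|).
Proof.
move=> LK Lr.
rewrite -[(#|K| - _)%N](_ : #|K :\: L| = _); last first.
  by rewrite cardsD (setIidPr LK).
rewrite -cards_draws -(card_in_imset (f := fun A => A :|: L)); last first.
  move=> A B; rewrite !inE => /andP[AK _] /andP[BK _] eAB.
  have dis (X : {set 'I_n}) : X \subset K :\: L -> (X :|: L) :\: L = X.
    rewrite subsetD => /andP[_ dX]; rewrite setDUl setDv setU0.
    by apply/setDidPl.
  by rewrite -(dis _ AK) -(dis _ BK) eAB.
apply: eq_card => J; rewrite !inE; apply/idP/imsetP => [/and3P[/eqP cJ LJ JK]|[A]].
  exists (J :\: L); last first.
    apply/setP => x; rewrite !inE; case: (boolP (x \in L)) => [/(subsetP LJ) ->|];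
      by rewrite ?orbT ?orbF.
  by rewrite inE setSD //= cardsD (setIidPr LJ) cJ.
rewrite inE subsetD => /andP[/andP[AK dAL] /eqP cA] ->.
rewrite subsetUr subUset AK LK cardsU (disjoint_setI0 dAL) cards0 subn0 cA.
by rewrite subnK ?eqxx.
Qed.

(** The test is needed because ['C(n - u, k - u)] is 1, not 0, if [k < u]. *)
Definition extensions (n k u : nat) : nat :=
  if (u <= k)%N then 'C(n - u, k - u) else 0.

Lemma card_extensions (n k : nat) (U : {set 'I_n}) :
  #|[set K in rsets n k | U \subset K]| = extensions n k #|U|.
Proof.
rewrite /extensions; case: leqP => [Uk|kU].
  have := card_between (subsetT U) Uk; rewrite cardsT card_ord => <-.
  by apply: eq_card => K; rewrite !inE subsetT andbT.
apply/eqP; rewrite cards_eq0; apply/eqP/setP => K; rewrite !inE.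
apply/negbTE; apply: contraL kU => /andP[/eqP <- /subset_leq_card].
by rewrite -leqNgt.
Qed.

(** Sorting the members [J] of [F] by their trace [J :&: L] bounds the number of
    [k]-sets containing [L] and some member of [F] by the degrees of smaller sets,
    on which one can induct. *)
Lemma joint_extensions (n k j : nat) (F : {set {set 'I_n}}) (L : {set 'I_n}) :
  F \subset rsets n j ->
  (\sum_(J in F | ~~ (L \subset J)) extensions n k #|J :|: L|
   <= \sum_(I : {set 'I_n} | I \proper L)
        set_degree I F * extensions n k (j + #|L| - #|I|))%N.
Proof.
move=> Fj.
rewrite (partition_big (fun J => J :&: L) (fun I => I \proper L)) /=; last first.
  by move=> J /andP[_ LJ]; rewrite properE subsetIr subsetI subxx andbT.
apply: leq_sum => I IL.
rewrite /set_degree -sum_nat_const.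
rewrite [leqRHS](bigID (fun J : {set 'I_n} => (~~ (L \subset J)) && (J :&: L == I))) /=.
apply: leq_trans (leq_addr _ _).
rewrite (eq_bigr (fun=> extensions n k (j + #|L| - #|I|))); last first.
  move=> J /andP[/andP[JF _] /eqP eI]; rewrite cardsU eI.
  by have := subsetP Fj _ JF; rewrite mem_rsets => /eqP ->.
rewrite !sum_nat_const leq_mul2r subset_leq_card ?orbT //.
apply/subsetP => J; rewrite -!topredE /= => /andP[/andP[JF LJ] /eqP eI]; rewrite inE.
by rewrite JF LJ -eI subsetIl eqxx.
Qed.

(** * Exploration of the search *)

Section Exploration.
Variables (n k j : nat).
Implicit Types (H A D F G P : {set {set 'I_n}}) (J K L : {set 'I_n}).

Definition jsubs K : {set {set 'I_n}} := [set J in rsets n j | J \subset K].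

(** The [k]-sets queried in the round at whose beginning [G] is discovered, if [P]
    was discovered one round earlier. *)
Definition candidates P G : {set {set 'I_n}} :=
  [set K in rsets n k | [exists J in G, J \subset K]
                        && [forall J in P, ~~ (J \subset K)]].

Definition reveal H A K : {set {set 'I_n}} := if K \in H then A :|: jsubs K else A.

(** One round; [A] is the set discovered so far, handed over to [kont]. *)
Fixpoint block (m : {set {set 'I_n}} -> {set 'I_n} -> bool)
    (s : seq {set 'I_n}) A (kont : {set {set 'I_n}} -> strategy {set 'I_n}) :=
  if s is K :: s' then Query K (m A K) (block m s' (A :|: jsubs K) kont)
                                       (block m s' A kont)
  else kont A.

(** What a choice of counted queries may depend on, all of it known before the
    answer: the round, the generation explored in it, the sets discovered so far and
    the queried set. *)
Definition rule := nat -> {set {set 'I_n}} -> {set {set 'I_n}} -> {set 'I_n} -> bool.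

Fixpoint exploration (m : rule) (f t : nat) P G : strategy {set 'I_n} :=
  if f is f'.+1 then
    block (m t (G :\: P)) (enum (candidates P G)) G (exploration m f' t.+1 G)
  else Halt.

Fixpoint block_asked (m : {set {set 'I_n}} -> {set 'I_n} -> bool) H
    (s : seq {set 'I_n}) A : nat :=
  if s is K :: s' then (m A K + block_asked m H s' (reveal H A K))%N else 0.

Fixpoint block_found (m : {set {set 'I_n}} -> {set 'I_n} -> bool) H
    (s : seq {set 'I_n}) A : nat :=
  if s is K :: s' then
    ((m A K && (K \in H)) + block_found m H s' (reveal H A K))%N
  else 0.

Lemma asked_block m s A kont H :
  asked (block m s A kont) H
    = (block_asked m H s A + asked (kont (foldl (reveal H) A s)) H)%N.
Proof.
elim: s A => //= K s IH A; rewrite -addnA; congr (_ + _)%N.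
by rewrite /reveal; case: (K \in H); rewrite IH.
Qed.

Lemma found_block m s A kont H :
  found (block m s A kont) H
    = (block_found m H s A + found (kont (foldl (reveal H) A s)) H)%N.
Proof.
elim: s A => //= K s IH A; rewrite -addnA; congr (_ + _)%N.
by rewrite /reveal; case: (K \in H); rewrite IH.
Qed.

Lemma fresh_block (U : {set {set 'I_n}}) m s A kont :
  uniq s -> {subset s <= U} ->
  (forall A', A \subset A' -> fresh (U :\: [set K in s]) (kont A')) ->
  fresh U (block m s A kont).
Proof.
elim: s U A => [|K s IH] U A /=.
  move=> _ _ fk; apply: fresh_sub (fk A (subxx _)); exact: subsetDl.
move=> /andP[Ks us] sU fk; rewrite sU ?mem_head //=.
have sub : {subset s <= U :\ K}.
  move=> K' K's; rewrite !inE sU ?in_cons ?K's ?orbT // andbT.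
  by apply: contraNneq Ks => <-.
have eU : U :\: [set K' in K :: s] = (U :\ K) :\: [set K' in s].
  by apply/setP => K'; rewrite !inE negb_or -andbA andbCA.
by apply/andP; split; apply: IH => // A' AA'; rewrite -eU; apply: fk => //;
  apply: subset_trans AA'; rewrite ?subsetUl.
Qed.

(** A [k]-set queried in one round contains a [j]-set of [G]; those of the later
    rounds contain none. *)
Lemma fresh_exploration (m : rule) f t P G : P \subset G ->
  fresh [set K in rsets n k | [forall J in P, ~~ (J \subset K)]]
        (exploration m f t P G).
Proof.
elim: f t P G => //= f IH t P G PG.
apply: fresh_block; first exact: enum_uniq.
  by move=> K; rewrite mem_enum !inE => /and3P[-> _ ->].
move=> A GA; apply: fresh_sub (IH t.+1 G A GA).
apply/subsetP => K; rewrite !inE => /andP[cK /forall_inP nK].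
rewrite cK /= mem_enum !inE cK /= negb_and; apply/andP; split.
  by rewrite negb_exists_in; apply/orP; left; apply/forall_inP.
by apply/forall_inP => J JP; apply: nK; apply: (subsetP PG).
Qed.

Lemma mem_foldl_reveal H s A J :
  (J \in foldl (reveal H) A s)
    = (J \in A) || ((#|J| == j) && has (fun K => (K \in H) && (J \subset K)) s).
Proof.
elim: s A => [|K s IH] A /=; first by rewrite andbF orbF.
rewrite IH /reveal; case: (K \in H) => //=; rewrite !inE.
by case: (J \in A) => //=; case: (#|J| == j) => //=.
Qed.

Lemma count_enum (m : pred {set 'I_n}) (X : {set {set 'I_n}}) :
  count m (enum X) = #|[set K in X | m K]|.
Proof.
rewrite -size_filter cardE; apply/perm_size/uniq_perm;
  [exact/filter_uniq/enum_uniq | exact: enum_uniq |].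
by move=> K; rewrite mem_filter !mem_enum inE andbC.
Qed.

Lemma block_asked_static (m : pred {set 'I_n}) H s A :
  block_asked (fun=> m) H s A = count m s.
Proof. by elim: s A => //= K s IH A; rewrite IH. Qed.

Lemma block_found_static (m : pred {set 'I_n}) H s A :
  block_found (fun=> m) H s A = count (fun K => m K && (K \in H)) s.
Proof. by elim: s A => //= K s IH A; rewrite IH. Qed.

Variable J1 : {set 'I_n}.

Notation reach H := (reach k j H J1).

(** Generation [t + 1]: the offset makes generation 1 the start of a recursion. *)
Definition front H (t : nat) : {set {set 'I_n}} := reach H t.+1 :\: reach H t.

Definition round_asked (m : rule) H t : nat :=
  block_asked (m t (front H t)) H (enum (candidates (reach H t) (reach H t.+1)))
    (reach H t.+1).

Definition round_found (m : rule) H t : nat :=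
  block_found (m t (front H t)) H (enum (candidates (reach H t) (reach H t.+1)))
    (reach H t.+1).

Lemma candidates_front H t K : K \in candidates (reach H t) (reach H t.+1) ->
  exists2 J, J \in front H t & J \subset K.
Proof.
rewrite !inE => /and3P[_ /existsP[J /andP[JG JK]] /forall_inP nK].
exists J => //; rewrite inE JG andbT; apply: contraL JK => JP; exact: nK.
Qed.

Lemma foldl_reveal_reach H t :
  foldl (reveal H) (reach H t.+1) (enum (candidates (reach H t) (reach H t.+1)))
    = reach H t.+2.
Proof.
apply/setP => J; rewrite mem_foldl_reveal reachSE in_setU.
case: (boolP (J \in reach H t.+1)) => //= nJ.
apply/andP/spreadP => [[/eqP cJ /hasP[K]]|[cJ [K [J' [KH cK JK J'D J'K]]]]].
  rewrite mem_enum => Kc /andP[KH JK]; split=> //.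
  have [J' J'D J'K] := candidates_front Kc.
  by exists K, J'; split=> //; move: Kc; rewrite !inE => /andP[/eqP].
rewrite cJ eqxx; split=> //; apply/hasP; exists K; last by rewrite KH.
rewrite mem_enum !inE cK eqxx /=; apply/andP; split.
  by apply/existsP; exists J'; rewrite J'K andbT; move: J'D; rewrite inE => /andP[].
apply/forall_inP => J'' J''P; apply: contra nJ => J''K.
apply: (subsetP (spread_reach _ _ _ _ _)); apply/spreadP; split=> //.
by exists K, J''.
Qed.

Lemma asked_exploration (m : rule) f H t :
  asked (exploration m f t (reach H t) (reach H t.+1)) H
    = (\sum_(t <= s < t + f) round_asked m H s)%N.
Proof.
elim: f t => [|f IH] t /=; first by rewrite addn0 big_geq.
rewrite asked_block foldl_reveal_reach IH addSnnS.
by rewrite [RHS]big_ltn // -addSnnS leq_addr.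
Qed.

Lemma found_exploration (m : rule) f H t :
  found (exploration m f t (reach H t) (reach H t.+1)) H
    = (\sum_(t <= s < t + f) round_found m H s)%N.
Proof.
elim: f t => [|f IH] t /=; first by rewrite addn0 big_geq.
rewrite found_block foldl_reveal_reach IH addSnnS.
by rewrite [RHS]big_ltn // -addSnnS leq_addr.
Qed.

(** A candidate containing [L] is a pivot if the frontier has a set between the
    two; such a candidate has one set above [L] fewer to contribute. Otherwise it
    is a jump to [L]. *)
Definition pivot L D K : bool :=
  (L \subset K) && [exists J in D, (L \subset J) && (J \subset K)].
Definition jump L D K : bool :=
  (L \subset K) && ~~ [exists J in D, (L \subset J) && (J \subset K)].

Definition pivot_rule L : rule := fun _ D _ => pivot L D.
Definition jump_rule L : rule := fun _ D _ => jump L D.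

(** If such a [k]-set is an edge, then all its [j]-sets but the one it is queried
    from are new at that moment. Hence distinct edges of this kind contribute
    disjoint sets to the next generation, even if they intersect. *)
Definition lonely_rule : rule := fun _ _ A K => (#|jsubs K :&: A| <= 1)%N.

Lemma round_asked_static (m : {set {set 'I_n}} -> pred {set 'I_n}) H t :
  round_asked (fun _ D _ => m D) H t
    = #|[set K in candidates (reach H t) (reach H t.+1) | m (front H t) K]|.
Proof. by rewrite /round_asked block_asked_static count_enum. Qed.

Lemma round_found_static (m : {set {set 'I_n}} -> pred {set 'I_n}) H t :
  round_found (fun _ D _ => m D) H t
    = #|[set K in candidates (reach H t) (reach H t.+1)
         | m (front H t) K && (K \in H)]|.
Proof. by rewrite /round_found block_found_static count_enum. Qed.

Lemma front_rsets H t : J1 \in rsets n j -> front H t \subset rsets n j.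
Proof. by move=> J1j; apply: subset_trans (subsetDl _ _) (reach_rsets _ _ J1j _). Qed.

(** Every new set above [L] lies in an edge among the candidates above [L]; if that
    edge is a pivot, one of its [j]-sets above [L] was known before. *)
Lemma front_degree L H t : (#|L| <= j <= k)%N -> J1 \in rsets n j ->
  (set_degree L (front H t.+1)
   <= ('C(k - #|L|, j - #|L|) - 1) * round_found (pivot_rule L) H t
      + 'C(k - #|L|, j - #|L|) * round_found (jump_rule L) H t)%N.
Proof.
move=> /andP[Lj jk] J1j; rewrite !round_found_static.
set C := candidates _ _; set c := 'C(_, _).
pose X (K : {set 'I_n}) :=
  [set J in rsets n j | (L \subset J) && (J \subset K)] :\: reach H t.+1.
pose N := [set K in C | (L \subset K) && (K \in H)].
have cov : [set J in front H t.+1 | L \subset J] \subset \bigcup_(K in N) X K.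
  apply/subsetP => J; rewrite inE => /andP[JF LJ].
  have : J \in reach H t.+2 by move: JF; rewrite inE => /andP[].
  rewrite -foldl_reveal_reach mem_foldl_reveal => /orP[JG|/andP[cJ /hasP[K]]].
    by move: JF; rewrite inE JG.
  rewrite mem_enum => KC /andP[KH JK]; apply/bigcupP; exists K.
    by rewrite inE KC KH (subset_trans LJ JK).
  by rewrite !inE cJ LJ JK !andbT; move: JF; rewrite inE => /andP[].
have cX K : K \in N -> (#|X K| <= c - (pivot L (front H t) K))%N.
  rewrite !inE => /andP[/andP[/eqP cK _] /andP[LK KH]].
  have := card_between LK Lj; rewrite cK /X /c => <-; case: (boolP (pivot _ _ _)) => [|_].
    move=> /andP[_ /existsP[J /and3P[JF LJ JK]]].
    have JG : J \in reach H t.+1 by move: JF; rewrite inE => /andP[].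
    rewrite cardsD leq_sub2l // card_gt0; apply/set0Pn; exists J.
    rewrite in_setI JG andbT inE LJ JK !andbT.
    exact: (subsetP (reach_rsets k H J1j t.+1)).
  by rewrite subn0 subset_leq_card // subsetDl.
apply: leq_trans (subset_leq_card cov) _.
apply: (@leq_trans (\sum_(K in N) #|X K|)).
  exact: card_bigcup_leq.
apply: leq_trans (leq_sum _ cX) _.
rewrite (bigID (pivot L (front H t))) /=; apply: leq_add.
  rewrite (eq_bigr (fun=> (c - 1)%N)); last by move=> K /andP[_ ->].
  rewrite sum_nat_const mulnC leq_mul2l subset_leq_card ?orbT //.
  apply/subsetP => K /andP[KN pK].
  by move: KN; rewrite in_set => /andP[KC /andP[_ KH]]; rewrite in_set KC pK.
rewrite (eq_bigr (fun=> c)); last by move=> K /andP[_ /negbTE ->]; rewrite subn0.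
rewrite sum_nat_const mulnC leq_mul2l subset_leq_card ?orbT //.
apply/subsetP => K /andP[KN pK].
move: KN pK; rewrite in_set => /andP[KC /andP[LK KH]].
by rewrite in_set KC KH /pivot /jump LK /= andbT.
Qed.

Lemma asked_pivot L H t : J1 \in rsets n j ->
  (round_asked (pivot_rule L) H t <= set_degree L (front H t) * extensions n k j)%N.
Proof.
move=> J1j; rewrite round_asked_static.
set X := [set K in _ | _].
apply: (@leq_trans (\sum_(J in [set J in front H t | L \subset J])
                      #|[set K in rsets n k | J \subset K]|)); last first.
  rewrite /set_degree -sum_nat_const leq_sum // => J; rewrite inE => /andP[JF _].
  rewrite card_extensions; have := subsetP (front_rsets H t J1j) _ JF.
  by rewrite mem_rsets => /eqP ->.
apply: (@leq_trans #|\bigcup_(J in [set J in front H t | L \subset J])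
                      [set K in rsets n k | J \subset K]|).
  apply/subset_leq_card/subsetP => K; rewrite !inE /pivot.
  move=> /andP[/andP[cK _] /andP[_ /existsP[J /and3P[JF LJ JK]]]].
  by apply/bigcupP; exists J; rewrite !inE ?cK ?JK // LJ andbT; rewrite inE in JF.
exact: card_bigcup_leq.
Qed.

Lemma asked_jump L H t : J1 \in rsets n j ->
  (round_asked (jump_rule L) H t
   <= \sum_(I : {set 'I_n} | I \proper L)
        set_degree I (front H t) * extensions n k (j + #|L| - #|I|))%N.
Proof.
move=> J1j; apply: leq_trans (joint_extensions k L (front_rsets H t J1j)).
rewrite round_asked_static.
under eq_bigr do rewrite -card_extensions.
apply: (@leq_trans #|\bigcup_(J in front H t | ~~ (L \subset J))
                      [set K in rsets n k | J :|: L \subset K]|).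
  apply/subset_leq_card/subsetP => K; rewrite inE /jump.
  move=> /andP[Kc /andP[LK nK]]; have [J JF JK] := candidates_front Kc.
  apply/bigcupP; exists J.
    rewrite JF; apply: contra nK => LJ; apply/existsP; exists J.
    by rewrite JF LJ.
  by move: Kc; rewrite !inE subUset LK JK => /andP[->].
exact: card_bigcup_leq.
Qed.

Lemma card_jsubs K : (j <= k)%N -> #|K| = k -> #|jsubs K| = 'C(k, j).
Proof.
move=> jk cK; have l0 : (#|@set0 'I_n| <= j)%N by rewrite cards0.
have := card_between (sub0set K) l0; rewrite cards0 !subn0 cK => <-.
by apply: eq_card => J; rewrite !inE sub0set.
Qed.

Lemma lonely_found H t : (j <= k)%N ->
  (('C(k, j) - 1) * round_found lonely_rule H t <= #|front H t.+1|)%N.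
Proof.
move=> jk; rewrite /round_found; set s := enum _; set A := reach H t.+1.
rewrite /front -foldl_reveal_reach -/s -/A.
have sub (s' : seq _) (A' : {set {set 'I_n}}) : A' \subset foldl (reveal H) A' s'.
  by apply/subsetP => J; rewrite mem_foldl_reveal => ->.
rewrite cardsD (setIidPr (sub s A)) leq_subRL ?subset_leq_card // addnC.
have : {in s, forall K, #|K| = k}.
  by move=> K; rewrite mem_enum !inE => /andP[/eqP].
elim: s A => [|K s IH] A /= cs; first by rewrite muln0.
have /IH {}IH : {in s, forall K, #|K| = k}.
  by move=> K' K's; apply: cs; rewrite in_cons K's orbT.
apply: leq_trans (IH _); rewrite mulnDr addnAC [leqRHS]addnC leq_add2r addnC.
rewrite /reveal /lonely_rule; case: (K \in H); last by rewrite andbF muln0 addn0.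
rewrite andbT; case: (boolP (_ <= 1)%N) => [one|_]; last first.
  by rewrite /= muln0 addn0 subset_leq_card ?subsetUl.
rewrite muln1 cardsU -addnBA; last by rewrite subset_leq_card // subsetIr.
by rewrite leq_add2l card_jsubs ?cs ?mem_head // setIC leq_sub2l.
Qed.

(** A [k]-set above [J \in front H t] is asked for as a lonely one unless it also
    contains another set of [reach H t.+2]: nothing beyond that is discovered before
    the round ends. *)
Lemma lonely_asked H t : J1 \in rsets n j -> (j <= k)%N ->
  (#|front H t| * extensions n k j
   <= round_asked lonely_rule H t
      + \sum_(J in front H t) \sum_(I : {set 'I_n} | I \proper J)
          set_degree I (reach H t.+2) * extensions n k (j + j - #|I|))%N.
Proof.
move=> J1j jk; set G := reach H t.+2.
pose C := [set K in candidates (reach H t) (reach H t.+1) | #|jsubs K :&: G| <= 1]%N.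
have Gj : G \subset rsets n j by exact: reach_rsets.
have cj J : J \in front H t -> #|J| = j.
  by move=> JF; have := subsetP (front_rsets H t J1j) _ JF; rewrite mem_rsets => /eqP.
have fG J : J \in front H t -> J \in G.
  rewrite inE => /andP[_]; exact/subsetP/reach_sub.
have asked_ge : (#|C| <= round_asked lonely_rule H t)%N.
  rewrite /round_asked /C -count_enum; set s := enum _; set A := reach H t.+1.
  have : foldl (reveal H) A s \subset G by rewrite foldl_reveal_reach.
  elim: s A => //= K s IH A AG; apply: leq_add (IH _ AG).
  rewrite /lonely_rule; case: (boolP (_ <= 1)%N) => //= one.
  rewrite [(_ <= 1)%N](leq_trans (subset_leq_card _) one) // setIS //.
  apply: subset_trans AG; apply/subsetP => J JA; rewrite mem_foldl_reveal.
  by rewrite /reveal; case: ifP; rewrite ?in_setU JA.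
have one_each : (\sum_(J in front H t) #|[set K in C | J \subset K]| <= #|C|)%N.
  under eq_bigr do rewrite -sum1_card.
  under eq_bigr do (under eq_bigl do rewrite inE); rewrite /=.
  under eq_bigr do rewrite big_mkcondr /=.
  rewrite exchange_big -sum1_card; apply: leq_sum => K; rewrite inE => /andP[_].
  apply: leq_trans; rewrite -big_mkcondr sum1_card subset_leq_card //.
  apply/subsetP => J /andP[JF JK].
  by rewrite in_setI fG // andbT inE mem_rsets cj // eqxx.
rewrite -sum_nat_const.
apply: leq_trans (leq_add (leq_trans one_each asked_ge) (leqnn _)).
rewrite -big_split /=; apply: leq_sum => J JF.
rewrite -{1}(cj _ JF) -card_extensions.
have := @joint_extensions n k j G J Gj; rewrite (cj _ JF) => joint.
apply: leq_trans (leq_add (leqnn _) joint).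
under [X in (_ + X)%N]eq_bigr do rewrite -card_extensions.
apply: (@leq_trans (#|[set K in C | J \subset K] :|: \bigcup_(J' in G | ~~ (J \subset J'))
                      [set K in rsets n k | J' :|: J \subset K]|)).
  apply/subset_leq_card/subsetP => K; rewrite inE => /andP[Kk JK].
  case: (boolP [exists J' in G, ~~ (J \subset J') && (J' \subset K)]).
    move=> /existsP[J' /and3P[J'G nJ J'K]]; rewrite inE; apply/orP; right.
    by apply/bigcupP; exists J'; rewrite ?J'G // inE Kk subUset JK J'K.
  (* No second discovered set: [K] is new in this round and stays lonely. *)
  rewrite negb_exists => /forallP only; rewrite inE; apply/orP; left.
  have uniqJ J' : J' \in G -> J' \subset K -> J' = J.
    move=> J'G J'K; have := only J'; rewrite J'G J'K andbT negbK => JJ'.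
    apply/esym/eqP; rewrite eqEcard JJ' (cj J JF).
    by have := subsetP Gj _ J'G; rewrite mem_rsets => /eqP ->; rewrite leqnn.
  rewrite !inE JK andbT.
  move: Kk; rewrite mem_rsets => ->; rewrite andTb -andbA; apply/and3P; split.
  - by apply/existsP; exists J; rewrite JK andbT; move: JF; rewrite inE => /andP[].
  - apply/forall_inP => J' J'P; apply/negP => J'K.
    have J'G : J' \in G by apply: (subsetP (reach_mono k j H J1 _)) J'P; rewrite ltnW.
    by move: JF; rewrite -(uniqJ _ J'G J'K) in_setD J'P.
  - rewrite -(cards1 J); apply/subset_leq_card/subsetP => J'.
    rewrite in_setI inE => /andP[/andP[_ J'K] J'G].
    by rewrite inE; apply/eqP; apply: uniqJ.
apply: leq_trans (leq_of_leqif (leq_card_setU _ _)) _; rewrite leq_add2l.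
exact: card_bigcup_leq.
Qed.

End Exploration.

(** * Estimates *)

Lemma bin_subl_leq (k j l : nat) : (l <= j)%N -> (j <= k)%N ->
  ('C(k - l, j - l) <= 'C(k, j))%N.
Proof.
elim: l k j => [|l IH] k j; first by rewrite !subn0.
case: j => // j; case: k => // k; rewrite !ltnS !subSS => lj jk.
by apply: leq_trans (IH _ _ lj jk) _; rewrite binS leq_addl.
Qed.

(** Some [j]-sets of a [k]-set do not contain a given nonempty [L]: the source of
    the contraction. *)
Lemma bin_subl_ltn (k j l : nat) : (0 < l <= j)%N -> (j < k)%N ->
  ('C(k - l, j - l) < 'C(k, j))%N.
Proof.
case: l j k => // l [|j] [|k] //; rewrite !ltnS !subSS /= => lj jk.
apply: leq_ltn_trans (bin_subl_leq lj (ltnW jk)) _.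
by rewrite binS -[X in (X < _)%N]add0n ltn_add2r bin_gt0.
Qed.

Lemma extensionsS (n k u : nat) : (k <= n)%N ->
  (n * extensions n k u.+1 <= k * extensions n k u)%N.
Proof.
move=> kn; rewrite /extensions; case: ltnP => [uk|_]; last by rewrite muln0.
rewrite (ltnW uk) !subnS; set X := 'C(_, _); set Y := 'C(_, _).
have un : (u < n)%N by exact: leq_trans uk kn.
have e : ((n - u) * X = (k - u) * Y)%N.
  by rewrite /X /Y mul_bin_diag prednK // subn_gt0.
have XY : (X <= Y)%N.
  rewrite -(leq_pmul2l (m := n - u)) ?subn_gt0 // e leq_mul2r leq_sub2r ?orbT //.
rewrite -{1}(subnK (ltnW un)) -{1}(subnK (ltnW uk)) !mulnDl e leq_add2l.
by rewrite leq_mul2l XY orbT.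
Qed.

(** One more prescribed vertex, besides [u] others, costs a factor
    [(k - u) / (n - u) <= k / n]. *)
Lemma extensions_decay (R : realType) (n k j a : nat) : (0 < k <= n)%N -> (j <= k)%N ->
  (extensions n k (j + a))%:R
    <= k%:R ^+ k * 'C(n, k - j)%:R / n%:R ^+ a :> R.
Proof.
move=> /andP[k0 kn] jk.
have n0 : 0 < n%:R :> R by rewrite ltr0n (leq_trans k0 kn).
rewrite ler_pdivlMr ?exprn_gt0 // -!natrX -!natrM ler_nat mulnC.
have [ak|ka] := leqP a k; last first.
  by rewrite /extensions ifN ?muln0 // -ltnNge (leq_trans ka) ?leq_addl.
have step b : (n ^ b * extensions n k (j + b) <= k ^ b * 'C(n, k - j))%N.
  elim: b => [|b IH]; last first.
    rewrite addnS !expnS -mulnA mulnCA -mulnA.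
    apply: leq_trans (leq_mul (leqnn k) IH).
    by rewrite [leqRHS]mulnCA leq_mul2l extensionsS ?orbT.
  by rewrite addn0 !mul1n /extensions jk leq_bin2l // leq_subr.
by apply: leq_trans (step a) _; rewrite leq_mul2r leq_pexp2l ?orbT.
Qed.

(** A lower bound [(1 - j * (k - j) / n) * 'C(n, k - j)] for the extensions of a
    [j]-set, in a form without subtraction. *)
Lemma extensions_base (n k j : nat) : (j <= k)%N -> (0 < n)%N -> (0 < k - j)%N ->
  (n * 'C(n, k - j) <= n * extensions n k j + j * (k - j) * 'C(n, k - j))%N.
Proof.
move=> jk n0 kj0; rewrite /extensions jk.
have step i : (n * 'C(n, k - j) <= n * 'C(n - i, k - j) + i * (k - j) * 'C(n, k - j))%N.
  elim: i => [|i IH]; first by rewrite subn0 !mul0n addn0.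
  apply: leq_trans IH _; rewrite mulSn mulnDl addnA leq_add2r subnS.
  case eni: (n - i)%N => [|m] /=; first by rewrite leq_addr.
  rewrite -(prednK kj0) binS mulnDr leq_add2l (prednK kj0).
  apply: (@leq_trans (n * 'C(n.-1, (k - j).-1))).
    by rewrite leq_mul2l leq_bin2l ?orbT // -ltnS (prednK n0) -eni leq_subr.
  by rewrite mul_bin_diag (prednK kj0).
exact: step.
Qed.

Lemma set_degree_reach (n k j : nat) (H : {set {set 'I_n}}) (J1 L : {set 'I_n}) r :
  set_degree L (reach k j H J1 r)
    = (\sum_(0 <= t < r) set_degree L (front k j J1 H t))%N.
Proof.
elim: r => [|r IH].
  rewrite big_geq // /set_degree /=; apply/eqP; rewrite cards_eq0; apply/eqP/setP => J.
  by rewrite !inE.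
rewrite big_nat_recr // [RHS]/= -IH /set_degree /front.
set A := [set J in reach k j H J1 r | _]; set B := [set J in _ :\: _ | _].
have dis : A :&: B = set0.
  apply/setP => J; rewrite in_setI !in_set.
  by case: (J \in reach k j H J1 r); rewrite ?andbF.
rewrite -(cardsUI A B) dis cards0 addn0.
apply: eq_card => J; rewrite in_setU !in_set.
have := subsetP (reach_sub k j H J1 r) J.
case: (J \in reach k j H J1 r) => [-> //|_]; last by [].
  by rewrite orbF.
Qed.

Lemma set_degree0 (n : nat) (F : {set {set 'I_n}}) : set_degree set0 F = #|F|.
Proof. by apply: eq_card => J; rewrite inE sub0set andbT. Qed.

Lemma sum_proper_le (R : realType) (n j : nat) (L : {set 'I_n})
    (F : {set 'I_n} -> R) (b : R) : (#|L| <= j)%N -> 0 <= b ->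
  (forall I : {set 'I_n}, I \proper L -> F I <= b) ->
  \sum_(I : {set 'I_n} | I \proper L) F I <= 2 ^+ j * b.
Proof.
move=> Lj b0 Fb.
apply: (@le_trans _ _ (\sum_(I : {set 'I_n} | I \proper L) b)); first exact: ler_sum.
rewrite sumr_const -[leLHS]mulr_natl; apply: ler_wpM2r => //.
rewrite -natrX ler_nat; apply: leq_trans (leq_pexp2l _ Lj) => //.
rewrite -card_powerset subset_leq_card //; apply/subsetP => I.
by rewrite inE => /proper_sub.
Qed.

(** The tail events in linear form, by [1 + y <= expR y] alone: the factors
    [1 / (1 - x)] and [1 / (1 + x)] tend to 1 with [x], so a small [x] does not spoil
    the contraction. *)
Lemma upper_count (R : realType) (x p X N S : R) : 0 < x < 1 -> 0 <= p -> 0 <= N ->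
  x * X - p * (expR x - 1) * N < S -> X <= p * N / (1 - x) + S / x.
Proof.
move=> /andP[x0 x1] p0 N0 tail.
have e1 : expR x <= (1 - x)^-1.
  rewrite -[expR x]invrK lef_pV2 ?posrE ?invr_gt0 ?expR_gt0 ?subr_gt0 // -expRN.
  exact: expR_ge1Dx.
have e2 : expR x - 1 <= x / (1 - x).
  by apply: le_trans (lerB e1 (lexx 1)) _; rewrite le_eqVlt; apply/orP; left;
     apply/eqP; field; rewrite subr_eq0 gt_eqF.
have e3 : p * (expR x - 1) * N <= p * (x / (1 - x)) * N.
  by apply: ler_wpM2r => //; apply: ler_wpM2l.
rewrite -(ler_pM2l x0) mulrDr.
have -> : x * (S / x) = S by rewrite mulrCA divff ?mulr1 // gt_eqF.
have -> : x * (p * N / (1 - x)) = p * (x / (1 - x)) * N by ring.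
lra.
Qed.

Lemma lower_count (R : realType) (x p X N S : R) : 0 < x -> 0 <= p -> 0 <= N ->
  - x * X - p * (expR (- x) - 1) * N < S -> p * N / (1 + x) - S / x <= X.
Proof.
move=> x0 p0 N0 tail.
have x1 : 0 < 1 + x by lra.
have e1 : expR (- x) <= (1 + x)^-1.
  by rewrite expRN lef_pV2 ?posrE ?expR_gt0 // expR_ge1Dx.
have e2 : x / (1 + x) <= 1 - expR (- x).
  apply: le_trans _ (lerB (lexx 1) e1); rewrite le_eqVlt; apply/orP; left.
  by apply/eqP; field; rewrite gt_eqF.
have e3 : p * (x / (1 + x)) * N <= p * (1 - expR (- x)) * N.
  by apply: ler_wpM2r => //; apply: ler_wpM2l.
rewrite -(ler_pM2l x0) mulrBr.
have -> : x * (S / x) = S by rewrite mulrCA divff ?mulr1 // gt_eqF.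
have -> : x * (p * N / (1 + x)) = p * (x / (1 + x)) * N by ring.
lra.
Qed.

(** * Degrees outside the tail events *)

Section Constants.
Variables (R : realType) (k j : nat).

(** An edge found yields up to ['C(k, j) - 1] new [j]-sets, and at least one of them
    fails to lie above a given nonempty [L]: the contraction gains this fraction. *)
Definition gap : R := ('C(k, j) - 1)%:R^-1.
(** The exponent in the exponential moments, small against [gap]. *)
Definition rate : R := gap / 16.
(** [jump_const] and [noise_const] are the coefficients of the jumps and of the
    deviations in [window_recursion]. A set of fewer than [j] elements has at most
    [2 ^+ j] subsets to jump from, and what the contraction gains is a fraction of
    [gap]; therefore [degree_const ^+ l] solves the recursion for sets of size
    [l]. *)
Definition jump_const : R := 4 * 'C(k, j)%:R * k%:R ^+ k.
Definition noise_const : R := 2 * 'C(k, j)%:R / rate.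
Definition degree_const : R :=
  8 * (1 + noise_const + jump_const * 2 ^+ j) / gap.

Hypothesis jk : (0 < j < k)%N.

Lemma bin_ge2 : (1 < 'C(k, j))%N.
Proof.
have /andP[j0 jk'] := jk.
have jj : (0 < j <= j)%N by rewrite j0 leqnn.
by have := bin_subl_ltn jj jk'; rewrite subnn bin0.
Qed.

Lemma gap_gt0 : 0 < gap.
Proof. by rewrite invr_gt0 ltr0n subn_gt0 bin_ge2. Qed.

Lemma gap_le1 : gap <= 1.
Proof. by rewrite invf_le1 ?ler1n ?ltr0n subn_gt0 bin_ge2. Qed.

Lemma rate_bounds : 0 < rate < 1 / 2.
Proof. by have := gap_gt0; have := gap_le1; rewrite /rate; lra. Qed.

Lemma jump_const_ge0 : 0 <= jump_const.
Proof. by rewrite /jump_const !mulr_ge0 ?exprn_ge0. Qed.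

Lemma noise_const_ge0 : 0 <= noise_const.
Proof.
have /andP[r0 _] := rate_bounds.
by rewrite /noise_const !mulr_ge0 ?invr_ge0 ?(ltW r0).
Qed.

Lemma degree_const_ge1 : 1 <= degree_const.
Proof.
have t0 := gap_gt0; have t1 := gap_le1.
rewrite /degree_const ler_pdivlMr // mul1r.
have := noise_const_ge0; have := jump_const_ge0.
have : 0 <= 2 ^+ j :> R by rewrite exprn_ge0.
by nra.
Qed.

End Constants.

(** The argument for a fixed hypergraph [H] and [f] rounds, in which no tail event
    occurs; [S] stands for [n `^ (delta / 2)]. *)
Section GoodEvent.
Variables (R : realType) (n k j : nat) (p e lam S : R).
Variables (H : {set {set 'I_n}}) (J1 : {set 'I_n}) (f : nat).

Implicit Types L I : {set 'I_n}.

Local Notation tau := (gap R k j).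
Local Notation x := (rate R k j).
Local Notation c1 := (jump_const R k j).
Local Notation c2 := (noise_const R k j).
Local Notation Q := (degree_const R k j).
Local Notation M := ('C(n, k - j)%:R : R).
Local Notation nn := (n%:R : R).
Local Notation deg L t := ((set_degree L (front k j J1 H t))%:R : R).
Local Notation cumdeg L r := ((set_degree L (reach k j H J1 r))%:R : R).

Hypothesis jk : (0 < j < k)%N.
Hypothesis kn : (k <= n)%N.
Hypothesis J1j : J1 \in rsets n j.
Hypothesis p_ge0 : 0 <= p.
Hypothesis e_ge0 : 0 <= e.
Hypothesis e_small : e <= tau / 8.
Hypothesis pM : p * M = (1 + e) * tau.

Hypothesis pivot_tail : forall (L : {set 'I_n}) r0 r1, (#|L| < j)%N -> (r1 <= f)%N ->
  x * (\sum_(r0 <= t < r1) round_found k j J1 (pivot_rule L) H t)%:R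
  - p * (expR x - 1)
    * (\sum_(r0 <= t < r1) round_asked k j J1 (pivot_rule L) H t)%:R < S.
Hypothesis jump_tail : forall (L : {set 'I_n}) r0 r1, (#|L| < j)%N -> (r1 <= f)%N ->
  x * (\sum_(r0 <= t < r1) round_found k j J1 (jump_rule L) H t)%:R
  - p * (expR x - 1)
    * (\sum_(r0 <= t < r1) round_asked k j J1 (jump_rule L) H t)%:R < S.
Hypothesis lonely_tail : forall t, (t < f)%N ->
  - x * (round_found k j J1 (lonely_rule j) H t)%:R
  - p * (expR (- x) - 1) * (round_asked k j J1 (lonely_rule j) H t)%:R < S.

Hypothesis small_reach : forall t, (t < f)%N ->
  #|reach k j H J1 t.+1|%:R <= lam * nn ^+ j.
Hypothesis S_ge1 : 1 <= S.
Hypothesis S_cube : S ^+ 3 <= nn.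
Hypothesis S_growth : 512 / tau ^+ 3 <= S.
Hypothesis few_bad :
  2 ^+ j * Q ^+ j * k%:R ^+ k * (4 * lam + (2 + c2) / S) <= x / 2.
Hypothesis base_large : (j * (k - j))%:R / nn <= x / 2.

Let tau0 : 0 < tau := gap_gt0 R jk.
Let tau1 : tau <= 1 := gap_le1 R jk.
Let x0 : 0 < x. Proof. by have /andP[] := rate_bounds R jk. Qed.
Let x2 : x < 1 / 2. Proof. by have /andP[] := rate_bounds R jk. Qed.
Let xE : x = tau / 16. Proof. by []. Qed.
Let c1_ge0 : 0 <= c1 := jump_const_ge0 R k j.
Let c2_ge0 : 0 <= c2 := noise_const_ge0 R jk.
Let Q_ge1 : 1 <= Q := degree_const_ge1 R jk.
Let k0 : (0 < k)%N. Proof. by case/andP: jk => j0; apply: leq_trans. Qed.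
Let n0 : 0 < nn. Proof. by rewrite ltr0n (leq_trans k0 kn). Qed.
Let M0 : 0 <= M. Proof. by []. Qed.
Let S0 : 0 < S. Proof. exact: lt_le_trans ltr01 S_ge1. Qed.
Let jk' : (j <= k)%N. Proof. by case/andP: jk => _ /ltnW. Qed.
Let q0_tau : ('C(k, j) - 1)%:R * tau = 1.
Proof. by rewrite /gap divff // pnatr_eq0 -lt0n subn_gt0 bin_ge2. Qed.
Let pM2 : p * M <= 2.
Proof.
by rewrite pM; have := tau0; have := tau1; have := e_ge0; have := e_small; nra.
Qed.

(** A bound for the expected number of sets above [L] that pivots produce from one
    set above [L]; for [L = set0], where every edge is a pivot, there is no
    contraction, and any constant will do. *)
Definition contraction (L : {set 'I_n}) : R := if L == set0 then 4 else 1 - tau / 2.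

Lemma pivot_factor L : (#|L| < j)%N ->
  ('C(k - #|L|, j - #|L|) - 1)%:R * (p * M) / (1 - x) <= contraction L.
Proof.
move=> Lj; rewrite ler_pdivrMr ?subr_gt0; last by have := x2; lra.
rewrite /contraction; case: (boolP (L == set0)) => [/eqP ->|L0].
  rewrite cards0 !subn0 pM mulrCA q0_tau mulr1.
  by have := tau1; have := x2; have := e_small; lra.
have c_le : ('C(k - #|L|, j - #|L|) - 1)%:R <= ('C(k, j) - 1)%:R - 1 :> R.
  have Lj' : (0 < #|L| <= j)%N by rewrite card_gt0 L0 ltnW.
  have lt := bin_subl_ltn Lj' (proj2 (andP jk)); have ge2 := bin_ge2 jk.
  rewrite lerBrDr -[X in _ + X]/(1%:R) -natrD ler_nat.
  by move: lt ge2; case: 'C(k, j) => [|c]; case: 'C(k - _, _) => [|b] //;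
    rewrite !subn1 addn1 /=.
apply: (@le_trans _ _ ((('C(k, j) - 1)%:R - 1) * (p * M))).
  by apply: ler_wpM2r => //; rewrite mulr_ge0.
rewrite pM mulrBl mul1r mulrCA q0_tau mulr1 xE.
by have := tau0; have := tau1; have := e_ge0; have := e_small; nra.
Qed.

(** The recursion over a window of rounds: sets above [L] arise from pivots,
    with a contracting factor, and from jumps, controlled by the degrees of the
    proper subsets of [L]. *)
Lemma window_recursion (L : {set 'I_n}) r0 r1 : (#|L| < j)%N -> (r1 <= f)%N ->
  \sum_(r0 <= t < r1) deg L t.+1
  <= contraction L * (\sum_(r0 <= t < r1) deg L t)
     + c1 * (\sum_(I : {set 'I_n} | I \proper L)
               (\sum_(r0 <= t < r1) deg I t) / nn ^+ (#|L| - #|I|))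
     + c2 * S.
Proof.
move=> Lj r1f.
set cL := 'C(k - #|L|, j - #|L|).
set Xp := (\sum_(r0 <= t < r1) round_found k j J1 (pivot_rule L) H t)%N.
set Np := (\sum_(r0 <= t < r1) round_asked k j J1 (pivot_rule L) H t)%N.
set Xj := (\sum_(r0 <= t < r1) round_found k j J1 (jump_rule L) H t)%N.
set Nj := (\sum_(r0 <= t < r1) round_asked k j J1 (jump_rule L) H t)%N.
set W := \sum_(r0 <= t < r1) deg L t.
set V := \sum_(I : {set 'I_n} | _) _.
have x01 : 0 < x < 1 by rewrite x0 /=; have := x2; lra.
have hXp := upper_count x01 p_ge0 (ler0n _ Np) (pivot_tail r0 Lj r1f).
have hXj := upper_count x01 p_ge0 (ler0n _ Nj) (jump_tail r0 Lj r1f).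
have hW : \sum_(r0 <= t < r1) deg L t.+1 <= (cL - 1)%:R * Xp%:R + cL%:R * Xj%:R.
  rewrite -!natrM -natrD -natr_sum ler_nat /Xp /Xj !big_distrr /= -big_split /=.
  by apply: leq_sum => t _; apply: front_degree; rewrite // (ltnW Lj).
have hNp : Np%:R <= M * W.
  rewrite /Np natr_sum /W mulr_sumr; apply: ler_sum => t _.
  rewrite mulrC -natrM ler_nat; apply: leq_trans (asked_pivot k L H t J1j) _.
  by rewrite leq_mul2l /extensions jk' leq_bin2l ?orbT // leq_subr.
have hNj : Nj%:R <= k%:R ^+ k * M * V.
  rewrite /Nj natr_sum /V mulr_sumr.
  under [leRHS]eq_bigr do rewrite mulr_suml mulr_sumr.
  rewrite exchange_big /=; apply: ler_sum => t _.
  apply: le_trans (_ : _ <= (\sum_(I : {set 'I_n} | I \proper L)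
     set_degree I (front k j J1 H t) * extensions n k (j + #|L| - #|I|))%:R) _.
    by rewrite ler_nat; apply: asked_jump.
  rewrite natr_sum; apply: ler_sum => I IL.
  rewrite natrM mulrCA; apply: ler_wpM2l => //.
  rewrite -addnBA ?subset_leq_card ?proper_sub //.
  by apply: extensions_decay; rewrite ?k0.
have cL_le : cL%:R <= 'C(k, j)%:R :> R by rewrite ler_nat bin_subl_leq // ltnW.
have cL1_le : (cL - 1)%:R <= 'C(k, j)%:R :> R.
  by apply: le_trans cL_le; rewrite ler_nat leq_subr.
have W0 : 0 <= W by apply: sumr_ge0.
have V0 : 0 <= V.
  by apply: sumr_ge0 => I _; rewrite mulr_ge0 ?invr_ge0 ?exprn_ge0 ?sumr_ge0 // ltW.
have ix : 0 <= (1 - x)^-1 by rewrite invr_ge0; have := x2; lra.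
have ix2 : (1 - x)^-1 <= 2.
  by rewrite -[leRHS]invrK lef_pV2 ?posrE ?invr_gt0 //; have := x2; lra.
have Sx : 0 <= S / x by rewrite divr_ge0 // ltW.
have partp : (cL - 1)%:R * Xp%:R <= contraction L * W + 'C(k, j)%:R * (S / x).
  apply: le_trans (ler_wpM2l (ler0n _ _) hXp) _; rewrite mulrDr; apply: lerD.
    apply: le_trans (ler_wpM2r W0 (pivot_factor Lj)).
    rewrite -/cL -!mulrA; apply: ler_wpM2l => //; apply: ler_wpM2l => //.
    rewrite mulrC [leRHS]mulrCA; apply: ler_wpM2l => //.
  exact: ler_wpM2r.
have partj : cL%:R * Xj%:R <= c1 * V + 'C(k, j)%:R * (S / x).
  apply: (@le_trans _ _ ('C(k, j)%:R * Xj%:R)); first exact: ler_wpM2r.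
  apply: le_trans (ler_wpM2l (ler0n _ _) hXj) _; rewrite mulrDr lerD2r.
  rewrite /jump_const -!mulrA [leRHS]mulrCA; apply: ler_wpM2l => //.
  have pN : p * Nj%:R <= 2 * (k%:R ^+ k * V).
    apply: le_trans (ler_wpM2l p_ge0 hNj) _.
    rewrite [leLHS](_ : _ = p * M * (k%:R ^+ k * V)); last by ring.
    by apply: ler_wpM2r; rewrite ?mulr_ge0 ?exprn_ge0.
  rewrite mulrA mulrC [leRHS](_ : _ = 2 * (2 * (k%:R ^+ k * V))); last by ring.
  by apply: ler_pM; rewrite ?mulr_ge0.
have -> : c2 * S = 'C(k, j)%:R * (S / x) + 'C(k, j)%:R * (S / x).
  by rewrite /noise_const; ring.
by apply: le_trans hW _; lra.
Qed.

Let nn1 : 1 <= nn. Proof. by rewrite ler1n (leq_trans k0 kn). Qed.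
Let S_sq : S <= S ^+ 2. Proof. by rewrite expr2 ler_peMl // ltW. Qed.
Let Q0 : 0 <= Q. Proof. exact: le_trans Q_ge1. Qed.
Let tauQ : tau * Q = 8 * (1 + c2 + c1 * 2 ^+ j).
Proof. by rewrite /degree_const mulrC divfK // gt_eqF. Qed.

(** The induction hypothesis for [I], seen from [L] after a jump. *)
Lemma degree_descent (I L : {set 'I_n}) (T : R) : I \proper L -> 0 <= T ->
  Q ^+ #|I| * (T / nn ^+ #|I| + S ^+ 2) / nn ^+ (#|L| - #|I|)
  <= Q ^+ #|L|.-1 * (T / nn ^+ #|L| + S ^+ 2).
Proof.
move=> IL T0; have lt := proper_card IL.
rewrite -mulrA; apply: ler_pM.
- by rewrite exprn_ge0.
- by rewrite !mulr_ge0 ?invr_ge0 ?exprn_ge0 ?addr_ge0 ?divr_ge0 ?exprn_ge0 // ltW.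
- by apply: ler_weXn2l => //; rewrite -ltnS prednK // (leq_trans _ lt).
rewrite mulrDl; apply: lerD.
  by rewrite -mulrA -invfM -exprD subnKC // ltnW.
rewrite ler_pdivrMr ?exprn_gt0 // ler_peMr ?exprn_ge0 ?exprn_ege1 //.
exact: ltW.
Qed.

Lemma reach_degree_sum L r :
  cumdeg L r = \sum_(0 <= t < r) deg L t.
Proof. by rewrite set_degree_reach natr_sum. Qed.

Lemma deg0_le1 L : deg L 0 <= 1.
Proof.
rewrite -[leRHS]/(1%:R) ler_nat -(cards1 J1) /set_degree /front /= setD0.
by apply/subset_leq_card/subsetP => J; rewrite inE => /andP[].
Qed.

(** The window that starts at the beginning bounds all degrees of the discovered
    sets at once: there the recursion is an inequality for a single unknown. *)
Lemma reach_degree (L : {set 'I_n}) r : (#|L| < j)%N -> (r <= f)%N ->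
  cumdeg L r.+1
  <= Q ^+ #|L| * (#|reach k j H J1 r.+1|%:R / nn ^+ #|L| + S ^+ 2).
Proof.
move: {2}#|L|.+1 (ltnSn #|L|) => m; elim: m L => // m IH L Lm Lj rf.
set T := #|reach k j H J1 r.+1|%:R.
have T0 : 0 <= T by [].
case: (eqVneq L set0) => [->|L0].
  by rewrite set_degree0 cards0 !expr0 divr1 mul1r lerDl exprn_ge0 // ltW.
have l0 : (0 < #|L|)%N by rewrite card_gt0.
(* [D0 + D'] is the degree of [L] in all generations so far, and [D] omits the last
   one, so [D <= D0 + D'] turns the recursion into an inequality for [D0 + D']. *)
set Z := T / nn ^+ #|L| + S ^+ 2.
have Z_ge : S ^+ 2 <= Z by rewrite lerDr divr_ge0 // exprn_ge0 // ltW.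
have rec := window_recursion 0 Lj rf.
have sum_le I : \sum_(0 <= t < r) deg I t <= cumdeg I r.+1.
  by rewrite reach_degree_sum big_nat_recr //= lerDl.
have V_le : \sum_(I : {set 'I_n} | I \proper L)
               (\sum_(0 <= t < r) deg I t) / nn ^+ (#|L| - #|I|)
            <= 2 ^+ j * (Q ^+ #|L|.-1 * Z).
  apply: sum_proper_le; first exact: ltnW.
    by rewrite mulr_ge0 ?exprn_ge0 // (le_trans _ Z_ge) // exprn_ge0 // ltW.
  move=> I IL; apply: le_trans (degree_descent IL T0).
  apply: ler_wpM2r; first by rewrite invr_ge0 exprn_ge0 // ltW.
  apply: le_trans (sum_le I) _; apply: IH => //.
    by apply: leq_trans (proper_card IL) _; rewrite -ltnS.
  exact: ltn_trans (proper_card IL) Lj.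
move: rec; rewrite /contraction (negPf L0).
have := sum_le L; have := deg0_le1 L.
rewrite reach_degree_sum big_nat_recl //=.
set D0 := deg L 0; set D' := \sum_(0 <= t < r) deg L t.+1.
set D := \sum_(0 <= t < r) deg L t => hD0 hD rec.
have Y1 : 1 <= Q ^+ #|L|.-1 by apply: exprn_ege1.
have Z1 : 1 <= Z by apply: le_trans Z_ge; apply: le_trans S_sq.
have ZS : S <= Z by apply: le_trans Z_ge.
have QE : Q ^+ #|L| = Q * Q ^+ #|L|.-1 by rewrite -exprS prednK.
set Y := Q ^+ #|L|.-1 in V_le Y1 QE.
have ZYZ : Z <= Y * Z by rewrite ler_peMl // (le_trans ler01).
have cV := ler_wpM2l c1_ge0 V_le.
have cS : c2 * S <= c2 * (Y * Z) by apply: ler_wpM2l => //; apply: le_trans ZYZ.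
have half : (1 - tau / 2) * D <= (1 - tau / 2) * (D0 + D').
  by apply: ler_wpM2l => //; have := tau1; have := tau0; lra.
rewrite -(ler_pM2l tau0) QE [leRHS](_ : _ = tau * Q * (Y * Z)); last by ring.
rewrite tauQ.
have D0' : 0 <= tau * (D0 + D').
  by rewrite mulr_ge0 ?(ltW tau0) // addr_ge0 // sumr_ge0.
have YZ1 : 1 <= Y * Z by apply: le_trans ZYZ.
have P2 : 0 <= c1 * (2 ^+ j * (Y * Z)).
  by rewrite !mulr_ge0 ?exprn_ge0 // (le_trans ler01).
have P3 : 0 <= c2 * (Y * Z) by rewrite mulr_ge0 // (le_trans ler01).
rewrite [leRHS](_ : _ = 8 * (Y * Z) + 8 * (c2 * (Y * Z))
                     + 8 * (c1 * (2 ^+ j * (Y * Z)))); last by ring.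
by move: (c1 * _) cV P2 => u cV P2; lra.
Qed.

(** The last generation found may carry the discovered sets beyond the size at which
    the search stops, but hardly by more than a constant factor. *)
Lemma reach_growth t : (t < f)%N ->
  #|reach k j H J1 t.+2|%:R <= 1 + 4 * #|reach k j H J1 t.+1|%:R + c2 * S.
Proof.
move=> tf; have j0 : (0 < j)%N by case/andP: jk.
have := @window_recursion set0 0 t.+1; rewrite cards0 => /(_ j0 tf).
rewrite /contraction eqxx [X in c1 * X]big_pred0; last first.
  by move=> I /=; rewrite properE sub0set andbF.
rewrite mulr0 addr0 -reach_degree_sum set_degree0 => rec.
rewrite -[X in X <= _](congr1 (fun m => m%:R) (set_degree0 _)) reach_degree_sum.
rewrite big_nat_recl //= -addrA; apply: lerD rec; exact: deg0_le1.
Qed.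

(** As long as few [j]-sets are discovered, and these are spread evenly, almost
    all queries are made to [k]-sets without other discovered [j]-sets. *)
Lemma lonely_many t : (t < f)%N ->
  #|front k j J1 H t|%:R * M * (1 - x)
  <= (round_asked k j J1 (lonely_rule j) H t)%:R.
Proof.
move=> tf; have j0 : (0 < j)%N by case/andP: jk.
set F := #|front k j J1 H t|%:R : R; set T := #|reach k j H J1 t.+2|%:R : R.
have F0 : 0 <= F by []. have T0 : 0 <= T by [].
have nj0 : 0 < nn ^+ j by rewrite exprn_gt0.
have kk0 : 0 <= k%:R ^+ k :> R by rewrite exprn_ge0.
have Qj0 : 0 <= Q ^+ j by rewrite exprn_ge0 // (le_trans ler01).
have bad J : J \in front k j J1 H t ->
  \sum_(I : {set 'I_n} | I \proper J)
     cumdeg I t.+2 * (extensions n k (j + j - #|I|))%:R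
  <= 2 ^+ j * (Q ^+ j * k%:R ^+ k * M * (T / nn ^+ j + S ^+ 2 / nn)).
  move=> JF; have cJ : #|J| = j.
    by have := subsetP (front_rsets k H t J1j) _ JF; rewrite mem_rsets => /eqP.
  apply: sum_proper_le; first by rewrite cJ.
    rewrite mulr_ge0 ?mulr_ge0 ?addr_ge0 ?divr_ge0 ?exprn_ge0 // ltW //.
  move=> I IJ; have lt : (#|I| < j)%N by rewrite -cJ proper_card.
  rewrite -addnBA ?(ltnW lt) //.
  have b1 := reach_degree lt tf.
  have b2 : (extensions n k (j + (j - #|I|)))%:R
            <= k%:R ^+ k * M / nn ^+ (j - #|I|).
    by apply: extensions_decay; rewrite ?k0.
  apply: le_trans (ler_pM _ _ b1 b2) _ => //.
  rewrite [leLHS](_ : _ = Q ^+ #|I| * (k%:R ^+ k * M)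
     * ((T / nn ^+ #|I| + S ^+ 2) / nn ^+ (j - #|I|))); last by rewrite -/T; ring.
  apply: ler_pM.
  - by rewrite !mulr_ge0 ?exprn_ge0 // (le_trans ler01).
  - by rewrite !mulr_ge0 ?invr_ge0 ?exprn_ge0 ?addr_ge0 ?divr_ge0 ?exprn_ge0 // ltW.
  - rewrite -mulrA; apply: ler_wpM2r; first by rewrite mulr_ge0.
    by apply: ler_weXn2l => //; apply: ltnW.
  rewrite mulrDl; apply: lerD.
    by rewrite -mulrA -invfM -exprD subnKC // ltnW.
  apply: ler_wpM2l; first by rewrite exprn_ge0 // ltW.
  rewrite lef_pV2 ?posrE ?exprn_gt0 // -[leLHS]expr1.
  by apply: ler_weXn2l => //; rewrite subn_gt0.
have sparse : T / nn ^+ j + S ^+ 2 / nn <= 4 * lam + (2 + c2) / S.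
  have g := reach_growth tf; rewrite -/T in g.
  have T1 := small_reach tf.
  have SSn : S ^+ 2 / nn <= S^-1.
    rewrite ler_pdivrMr // mulrC ler_pdivlMr // -exprSr.
    exact: S_cube.
  have n_nj : nn <= nn ^+ j by rewrite -{1}[nn]expr1 ler_weXn2l.
  have SS2 : S / nn ^+ j <= S ^+ 2 / nn.
    apply: ler_pM; first exact: ltW.
    - by rewrite invr_ge0 ltW.
    - exact: S_sq.
    - by rewrite lef_pV2 ?posrE.
  have Sn1 : (nn ^+ j)^-1 <= S / nn ^+ j.
    by rewrite -{1}[_^-1]mul1r; apply: ler_wpM2r => //; rewrite invr_ge0 ltW.
  have cSn : c2 * (S / nn ^+ j) <= c2 * S^-1.
    by apply: ler_wpM2l => //; apply: le_trans SSn.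
  have : T / nn ^+ j <= (1 + 4 * (lam * nn ^+ j) + c2 * S) / nn ^+ j.
    apply: ler_wpM2r; first by rewrite invr_ge0 ltW.
    by apply: le_trans g _; lra.
  have -> : (1 + 4 * (lam * nn ^+ j) + c2 * S) / nn ^+ j
     = (nn ^+ j)^-1 + 4 * lam + c2 * (S / nn ^+ j).
    by field; rewrite gt_eqF.
  have -> : (2 + c2) / S = S^-1 + S^-1 + c2 * S^-1 by ring.
  move: (c2 * (S / _)) cSn => u cSn; move: (c2 * S^-1) cSn => v cSn.
  by lra.
have asked_ge : F * (extensions n k j)%:R
    - F * (2 ^+ j * (Q ^+ j * k%:R ^+ k * M * (T / nn ^+ j + S ^+ 2 / nn)))
    <= (round_asked k j J1 (lonely_rule j) H t)%:R.
  rewrite lerBlDr.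
  apply: (@le_trans _ _ (round_asked k j J1 (lonely_rule j) H t
      + \sum_(J in front k j J1 H t) \sum_(I : {set 'I_n} | I \proper J)
          set_degree I (reach k j H J1 t.+2) * extensions n k (j + j - #|I|))%:R).
    by rewrite /F -natrM ler_nat lonely_asked.
  rewrite natrD lerD2l natr_sum /F mulr_natl -sumr_const.
  apply: ler_sum => J JF; rewrite natr_sum; apply: le_trans (bad J JF).
  by apply: ler_sum => I _; rewrite natrM.
apply: le_trans asked_ge.
have base : M * (1 - x / 2) <= (extensions n k j)%:R.
  have kj0 : (0 < k - j)%N by rewrite subn_gt0; case/andP: jk.
  have := extensions_base jk' (leq_trans k0 kn) kj0.
  rewrite -(ler_nat R) natrD !natrM => b.
  rewrite -(ler_pM2l n0) mulrA mulrBr mulr1 lerBlDr.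
  apply: le_trans b _; rewrite lerD2l -natrM [leLHS]mulrC -mulrA mulrCA.
  apply: ler_wpM2l => //.
  by move: base_large; rewrite ler_pdivrMr // mulrC.
have spread_ok : 2 ^+ j * (Q ^+ j * k%:R ^+ k * M * (T / nn ^+ j + S ^+ 2 / nn))
    <= M * (x / 2).
  rewrite [leLHS](_ : _ = M * (2 ^+ j * Q ^+ j * k%:R ^+ k
                               * (T / nn ^+ j + S ^+ 2 / nn))); last by ring.
  apply: ler_wpM2l => //; apply: le_trans few_bad.
  by apply: ler_wpM2l => //; rewrite !mulr_ge0 ?exprn_ge0.
rewrite -mulrA -mulrBr; apply: ler_wpM2l => //.
apply: le_trans (lerB base spread_ok); rewrite -mulrBr.
by apply: ler_wpM2l => //; lra.
Qed.

(** Almost every query from a [j]-set is lonely, so its expected number of new sets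
    is nearly [1 + e >= 1]. *)
Lemma front_growth t : (t < f)%N ->
  #|front k j J1 H t|%:R
  <= (1 + tau / 4) * #|front k j J1 H t.+1|%:R + tau / 4 * S ^+ 2.
Proof.
move=> tf; set F := #|front k j J1 H t|%:R : R; set F' := #|front k j J1 H t.+1|%:R : R.
set q0 := ('C(k, j) - 1)%:R : R.
have many := lonely_many tf; have tail := lonely_tail tf.
have low := lower_count x0 p_ge0 (ler0n _ _) tail.
have := lonely_found J1 H t jk'.
rewrite -(ler_nat R) natrM -/q0 -/F' => fnd.
set X := (round_found k j J1 (lonely_rule j) H t)%:R in low fnd.
set N := (round_asked k j J1 (lonely_rule j) H t)%:R in low many.
have F0 : 0 <= F by []. have q00 : 0 <= q0 by [].
have xp : 0 < 1 + x by have := x0; lra.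
have x1 : 0 < 1 - x by have := x2; lra.
have X_ge : F * (1 - x) / (1 + x) - q0 * (S / x) <= F'.
  apply: le_trans fnd; apply: le_trans (ler_wpM2l q00 low).
  rewrite [leRHS]mulrBr lerB // [leRHS]mulrA; apply: ler_wpM2r; first by rewrite invr_ge0 ltW.
  apply: (@le_trans _ _ (q0 * (p * (F * M * (1 - x))))); last first.
    by apply: ler_wpM2l => //; apply: ler_wpM2l.
  rewrite [leRHS](_ : _ = q0 * (p * M) * (F * (1 - x))); last by ring.
  rewrite pM (_ : q0 * _ = 1 + e); last by rewrite /q0 mulrCA q0_tau mulr1.
  rewrite ler_peMl //; last by have := e_ge0; lra.
  by rewrite mulr_ge0 // ltW.
have q0E : q0 = tau^-1 by rewrite /gap invrK.
(* [S_growth]: the deviation, of order [S], is absorbed by [S ^+ 2 = n `^ delta]. *)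
have noise : 2 * (q0 * (S / x)) <= tau / 4 * S ^+ 2.
  rewrite q0E xE [leLHS](_ : _ = 32 / tau ^+ 2 * S); last by field; rewrite gt_eqF.
  rewrite [S ^+ 2]expr2 [leRHS]mulrA; apply: ler_wpM2r; first exact: ltW.
  have s1 : 512 <= S * tau ^+ 3 by rewrite -ler_pdivrMr ?exprn_gt0.
  rewrite ler_pdivrMr ?exprn_gt0 //.
  have -> : tau / 4 * S * tau ^+ 2 = S * tau ^+ 3 / 4 by ring.
  lra.
have ratio : (1 + x) / (1 - x) <= 1 + tau / 4.
  rewrite ler_pdivrMr // (_ : tau = 16 * x); last by rewrite xE; field.
  by have := x0; have := x2; nra.
have step : F <= (1 + x) / (1 - x) * (F' + q0 * (S / x)).
  rewrite -mulrA -ler_pdivrMl // ler_pdivlMl // mulrC.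
  by move: X_ge; rewrite lerBlDr; rewrite [F * _ / _]mulrAC mulrA [_^-1 * F]mulrC.
apply: le_trans step _.
have nn0 : 0 <= F' + q0 * (S / x).
  by rewrite addr_ge0 // mulr_ge0 // divr_ge0 // ltW.
apply: le_trans (ler_wpM2r nn0 ratio) _; rewrite mulrDr lerD2l.
apply: le_trans noise; apply: ler_wpM2r; first by rewrite mulr_ge0 // divr_ge0 // ltW.
by have := tau1; lra.
Qed.

(** The bound for a single generation: the contraction beats the possible loss
    in the size of the generation. *)
Lemma front_degree_bound (L : {set 'I_n}) t : (#|L| < j)%N -> (t <= f)%N ->
  deg L t <= Q ^+ #|L| * (#|front k j J1 H t|%:R / nn ^+ #|L| + S ^+ 2).
Proof.
move: {2}#|L|.+1 (ltnSn #|L|) => m; elim: m L t => // m IH L t Lm Lj.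
case: (eqVneq L set0) => [->|L0 tf].
  by rewrite set_degree0 cards0 !expr0 divr1 mul1r lerDl exprn_ge0 // ltW.
have l0 : (0 < #|L|)%N by rewrite card_gt0.
have SS1 : 1 <= S ^+ 2 by apply: le_trans S_sq.
have Y1 : 1 <= Q ^+ #|L|.-1 by apply: exprn_ege1.
have QE : Q ^+ #|L| = Q * Q ^+ #|L|.-1 by rewrite -exprS prednK.
elim: t tf => [_|t IHt tf].
  apply: le_trans (deg0_le1 L) _.
  rewrite -[leLHS]mulr1; apply: ler_pM => //; first exact: exprn_ege1.
  apply: le_trans SS1 _; rewrite lerDr divr_ge0 // exprn_ge0 // ltW.
have {}IHt := IHt (ltnW tf).
set F := #|front k j J1 H t|%:R : R in IHt; set F' := #|front k j J1 H t.+1|%:R : R.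
set N := nn ^+ #|L|; have N1 : 1 <= N by apply: exprn_ege1.
have N0 : 0 < N by apply: lt_le_trans ltr01 N1.
have rec := @window_recursion L t t.+1 Lj tf.
rewrite !big_nat1 /contraction (negPf L0) in rec.
move: rec; under [X in c1 * X]eq_bigr do rewrite big_nat1; move=> rec.
have F0 : 0 <= F by [].
set Z := F / N + S ^+ 2 in IHt.
have Z_ge : S ^+ 2 <= Z by rewrite lerDr divr_ge0 // ltW.
have V_le : \sum_(I : {set 'I_n} | I \proper L) deg I t / nn ^+ (#|L| - #|I|)
            <= 2 ^+ j * (Q ^+ #|L|.-1 * Z).
  apply: sum_proper_le; first exact: ltnW.
    by rewrite mulr_ge0 ?exprn_ge0 // (le_trans _ Z_ge) // exprn_ge0 // ltW.
  move=> I IL; apply: le_trans (degree_descent IL F0).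
  apply: ler_wpM2r; first by rewrite invr_ge0 exprn_ge0 // ltW.
  apply: IH; rewrite ?(ltnW tf) //.
    by apply: leq_trans (proper_card IL) _; rewrite -ltnS.
  exact: ltn_trans (proper_card IL) Lj.
set Y := Q ^+ #|L|.-1 in V_le Y1 QE.
have Z1 : 1 <= Z by apply: le_trans Z_ge.
have Z0 : 0 <= Z by apply: le_trans Z1.
have ZYZ : Z <= Y * Z by rewrite ler_peMl.
have cV := ler_wpM2l c1_ge0 V_le.
have cS : c2 * S <= c2 * (Y * Z).
  by apply: ler_wpM2l => //; apply: le_trans ZYZ; apply: le_trans Z_ge.
have half : (1 - tau / 2) * deg L t <= (1 - tau / 2) * (Q * Y * Z).
  by rewrite -QE; apply: ler_wpM2l => //; have := tau1; have := tau0; lra.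
(* The contraction leaves [1 - tau / 2], and [degree_const] was chosen such that the
   jumps and the deviation add at most [tau / 8]. *)
have step : deg L t.+1 <= (1 - 3 / 8 * tau) * (Q * Y * Z).
  apply: le_trans rec _.
  have -> : (1 - 3 / 8 * tau) * (Q * Y * Z)
    = (1 - tau / 2) * (Q * Y * Z) + tau * Q * (Y * Z) / 8 by field.
  rewrite tauQ.
  have -> : 8 * (1 + c2 + c1 * 2 ^+ j) * (Y * Z) / 8
    = Y * Z + c2 * (Y * Z) + c1 * (2 ^+ j * (Y * Z)) by field.
  have : 0 <= Y * Z by apply: le_trans ZYZ.
  move: (c1 * _) (c1 * (2 ^+ j * _)) cV => u v cV.
  by move: (c2 * S) (c2 * _) cS => u' v' cS; lra.
have grow : Z <= (1 + tau / 4) * (F' / N + S ^+ 2).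
  have iN : 0 <= N^-1 by rewrite invr_ge0 ltW.
  have := ler_wpM2r iN (front_growth tf).
  rewrite -/F -/F' [leRHS](_ : _ = (1 + tau / 4) * (F' / N) + tau / 4 * S ^+ 2 / N) => [g|];
    last by ring.
  have h : tau / 4 * S ^+ 2 / N <= tau / 4 * S ^+ 2.
    rewrite ler_pdivrMr // ler_peMr //.
    by rewrite mulr_ge0 ?exprn_ge0 ?divr_ge0 // ltW.
  rewrite /Z [leRHS](_ : _ = (1 + tau / 4) * (F' / N) + tau / 4 * S ^+ 2 + S ^+ 2);
    last by ring.
  by rewrite lerD2r; apply: le_trans g _; rewrite lerD2l.
apply: le_trans step _; rewrite QE.
have QY0 : 0 <= Q * Y by rewrite mulr_ge0 // (le_trans ler01).
have Z'0 : 0 <= F' / N + S ^+ 2.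
  by rewrite addr_ge0 ?exprn_ge0 ?divr_ge0 // ltW.
set Z' := F' / N + S ^+ 2 in grow Z'0 *.
have t0 : 0 <= 1 - 3 / 8 * tau by have := tau1; lra.
apply: le_trans (ler_wpM2l t0 (ler_wpM2l QY0 grow)) _.
rewrite [leLHS](_ : _ = (1 - 3 / 8 * tau) * (1 + tau / 4) * (Q * Y * Z')); last by ring.
have tt : 0 <= tau * tau by rewrite mulr_ge0 ?(ltW tau0).
apply: ler_piMl; first exact: mulr_ge0.
by have := tau0; lra.
Qed.

End GoodEvent.

(** * The union bound *)

(** A rule that is restricted to the rounds of a window is again a rule, so windows
    need no probabilistic argument of their own. *)
Lemma window_tail (R : realType) (n k j : nat) (p a s : R) (J1 : {set 'I_n})
    (m : rule n) (r0 r1 : nat) : 0 <= p <= 1 ->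
  hgprob k p (fun H => s <= a * (\sum_(r0 <= t < r1) round_found k j J1 m H t)%:R
    - p * (expR a - 1) * (\sum_(r0 <= t < r1) round_asked k j J1 m H t)%:R)
  <= expR (- s).
Proof.
move=> p01; have [r10|r01] := leqP r1 r0.
  rewrite hgprobE -[leRHS](expect_const p _ (rsets n k)).
  apply: ler_sum => H _; apply: ler_wpM2l; first exact: expect_weight_ge0.
  rewrite !big_geq // !mulr0 subr0; case: (boolP (s <= 0)) => /= s0.
    by rewrite -[leLHS]expR0 ler_expR oppr_ge0.
  exact: expR_ge0.
pose m' : rule n := fun t D A K => (r0 <= t)%N && m t D A K.
pose T := exploration k j m' r1 0 set0 [set J1].
have fT : fresh (rsets n k) T.
  apply: fresh_sub (fresh_exploration k j m' r1 0 (sub0set [set J1])).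
  by apply/subsetP => K; rewrite inE => /andP[].
have := strategy_tail a s p01 fT.
rewrite !hgprobE; apply: le_trans; apply: ler_sum => H _.
apply: ler_wpM2l; first exact: expect_weight_ge0.
have split_sum (F F' : nat -> nat) :
    (forall t, F t = if (r0 <= t)%N then F' t else 0%N) ->
    (\sum_(0 <= t < r1) F t = \sum_(r0 <= t < r1) F' t)%N.
  move=> FE; rewrite (big_cat_nat (leq0n r0) (ltnW r01)) /= big1_seq ?add0n.
    by apply: eq_big_nat => t /andP[r0t _]; rewrite FE r0t.
  by move=> t /andP[_]; rewrite mem_index_iota => /andP[_ tr]; rewrite FE leqNgt tr.
have := asked_exploration k j J1 m' r1 H 0; rewrite /= -/T add0n => ->.
have := found_exploration k j J1 m' r1 H 0; rewrite /= -/T add0n => ->.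
rewrite (split_sum _ (round_found k j J1 m H)); last first.
  move=> t; rewrite /round_found; case: leqP => [rt|tr].
    have -> : m' t = m t by rewrite /m' rt.
    by [].
  have -> : m' t (front k j J1 H t) = fun=> pred0 by rewrite /m' leqNgt tr.
  by rewrite (block_found_static j pred0) (@eq_count _ _ pred0) ?count_pred0.
rewrite (split_sum _ (round_asked k j J1 m H)) //.
move=> t; rewrite /round_asked; case: leqP => [rt|tr].
  have -> : m' t = m t by rewrite /m' rt.
  by [].
have -> : m' t (front k j J1 H t) = fun=> pred0 by rewrite /m' leqNgt tr.
by rewrite (block_asked_static j pred0) count_pred0.
Qed.

Lemma natr_bigmax_le (R : realType) (I : finType) (A : {set I}) (F : I -> nat) (b : R) :
  0 <= b -> (forall i, i \in A -> (F i)%:R <= b) -> (\max_(i in A) F i)%:R <= b.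
Proof.
move=> b0 Fb; apply: (big_ind (fun m => m%:R <= b)) => //= m1 m2 h1 h2.
by rewrite /maxn; case: ifP.
Qed.

Lemma bin_le_exp (n m : nat) : ('C(n, m) <= n ^ m)%N.
Proof.
elim: m => [|m IH]; first by rewrite bin0.
rewrite expnS; apply: leq_trans (leq_mul (leqnn n) IH).
apply: (@leq_trans (m.+1 * 'C(n, m.+1))); first by rewrite leq_pmull.
by rewrite mul_bin_left leq_mul2r leq_subr orbT.
Qed.

Lemma card_small_sets (n j : nat) : (0 < n)%N ->
  (#|[set L : {set 'I_n} | #|L| < j]| <= j * n ^ j)%N.
Proof.
move=> n0; apply: (@leq_trans #|\bigcup_(l : 'I_j) rsets n l|).
  apply/subset_leq_card/subsetP => L; rewrite inE => Lj.
  by apply/bigcupP; exists (Ordinal Lj); rewrite // mem_rsets.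
apply: leq_trans (card_bigcup_leq _ _) _.
apply: (@leq_trans (\sum_(l : 'I_j) n ^ j)); last by rewrite sum_nat_const card_ord.
apply: leq_sum => l _; rewrite /rsets card_draws card_ord.
by apply: leq_trans (bin_le_exp _ _) _; rewrite leq_pexp2l // ltnW.
Qed.

Section StoppingTime.
Variables (R : realType) (n k j : nat) (lam : R) (H : {set {set 'I_n}}).
Variables (sJ sK : seq {set 'I_n}) (J1 : {set 'I_n}).
Hypothesis sJ_perm : perm_eq sJ (enum (rsets n j)).
Hypothesis sK_perm : perm_eq sK (enum (rsets n k)).
Hypothesis J1j : J1 \in rsets n j.

Lemma generations_reach r :
  \bigcup_(1 <= s < r.+1) generation j sJ sK J1 H s = reach k j H J1 r.
Proof.
elim: r => [|r IH]; first by rewrite big_geq.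
rewrite big_nat_recr // IH (generation_reach H sK_perm sJ_perm J1j) [LHS]/=.
apply/setP => J; rewrite in_setU in_setD.
have := subsetP (reach_sub k j H J1 r) J.
by case: (J \in reach k j H J1 r) => [-> //|_].
Qed.

Lemma before_stop i t : (i <= bfs_stop_time j lam sJ sK J1 H)%N -> (t.+1 < i)%N ->
  front k j J1 H t != set0 /\ #|reach k j H J1 t.+1|%:R < lam * n%:R ^+ j.
Proof.
rewrite /bfs_stop_time; case: ex_minnP => m _ mmin im ti.
have : ~~ bfs_stop j lam sJ sK J1 H t.+1.
  apply/negP => st; have := mmin t.+1; rewrite st /= => /(_ isT) mt.
  by have := leq_trans ti (leq_trans im mt); rewrite ltnn.
rewrite /bfs_stop !negb_or generations_reach => /and3P[ne].
rewrite -ltNge => lt _; split=> //.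
by rewrite (generation_reach H sK_perm sJ_perm J1j) in ne.
Qed.

(** Each round discovers something. *)
Lemma rounds_le i : (i <= bfs_stop_time j lam sJ sK J1 H)%N -> (i.-1 <= n ^ j)%N.
Proof.
move=> i_stop.
have grow t : (t < i)%N -> (t <= #|reach k j H J1 t|)%N.
  elim: t => // t IH ti; have [ne _] := before_stop i_stop ti.
  apply: leq_ltn_trans (IH (ltnW ti)) _; apply: proper_card.
  rewrite properEneq reach_sub andbT; apply: contra ne => /eqP e.
  by rewrite /front -e setDv.
case: i i_stop grow => // i i_stop grow; apply: leq_trans (grow i (ltnSn i)) _.
apply: leq_trans (subset_leq_card (reach_rsets k H J1j i)) _.
by rewrite /rsets card_draws card_ord bin_le_exp.
Qed.

End StoppingTime.

(** The factor by which a density of discovered sets is multiplied when bounding the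
    fraction of queries that are not lonely. *)
Definition small_bias (R : realType) (k j : nat) : R :=
  2 ^+ j * degree_const R k j ^+ j * k%:R ^+ k.

(** The failure of the bound for generation [i] is charged to one of polynomially
    many tail events. *)
Lemma generation_tail (R : realType) (n k j : nat) (e lam S : R)
    (sJ sK : seq {set 'I_n}) (J1 : {set 'I_n}) (i l : nat) :
  (0 < j < k)%N -> (k < n)%N ->
  0 <= e -> e <= gap R k j / 8 ->
  1 <= S -> S ^+ 3 <= n%:R -> 512 / gap R k j ^+ 3 <= S ->
  small_bias R k j * (4 * lam + (2 + noise_const R k j) / S) <= rate R k j / 2 ->
  (j * (k - j))%:R / n%:R <= rate R k j / 2 ->
  perm_eq sJ (enum (rsets n j)) -> perm_eq sK (enum (rsets n k)) ->
  J1 \in rsets n j -> (0 < i)%N -> (l < j)%N ->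
  hgprob k (edge_prob k j n e) (fun H =>
     (i <= bfs_stop_time j lam sJ sK J1 H)%N &&
     ~~ ((max_degree l (generation j sJ sK J1 H i))%:R
           <= degree_const R k j ^+ l
              * (#|generation j sJ sK J1 H i|%:R / n%:R ^+ l + S ^+ 2)))
  <= (12 * j * n ^ (3 * j))%:R * expR (- S).
Proof.
move=> jk kn' e0 e_small S1 S3 Sg fb bl sJp sKp J1j i0 lj.
have /andP[j0 jk'] := jk; have kn := ltnW kn'.
have n0 : (0 < n)%N by apply: leq_ltn_trans kn'.
set p := edge_prob k j n e; set x := rate R k j.
have tau0 := gap_gt0 R jk; have tau1 := gap_le1 R jk.
have kj : (0 < k - j < n)%N.
  by rewrite subn_gt0 jk' (leq_ltn_trans (leq_subr _ _) kn').
have M2 : 2 <= 'C(n, k - j)%:R :> R by rewrite ler_nat bin_ge2.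
have pE : p * 'C(n, k - j)%:R = (1 + e) * gap R k j.
  rewrite /p /edge_prob /gap natrB ?divfK //; first by rewrite gt_eqF //; lra.
  exact: ltnW (bin_ge2 jk).
have p01 : 0 <= p <= 1.
  have p_eq : p = (1 + e) * gap R k j / 'C(n, k - j)%:R.
    by rewrite -pE mulfK // gt_eqF //; lra.
  rewrite p_eq ler_pdivrMr ?divr_ge0 ?mulr_ge0 ?addr_ge0 ?(ltW tau0) //=; last by lra.
  by rewrite mul1r; nra.
pose N := (n ^ j).+1.
pose bad (y : 'I_N * 'I_N * {set 'I_n} * 'I_3) (H : {set {set 'I_n}}) : bool :=
  let a : R := if y.2 == 2%N :> nat then - x else x in
  let m : rule n := if y.2 == 0%N :> nat then pivot_rule y.1.2
    else if y.2 == 1%N :> nat then jump_rule y.1.2 else lonely_rule j in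
  S <= a * (\sum_(y.1.1.1 <= t < y.1.1.2) round_found k j J1 m H t)%:R
       - p * (expR a - 1)
         * (\sum_(y.1.1.1 <= t < y.1.1.2) round_asked k j J1 m H t)%:R.
pose X := finset.setX (finset.setX [set: 'I_N * 'I_N]%SET
   [set L : {set 'I_n} | (#|L| < j)%N]%SET) [set: 'I_3]%SET.
(* [rounds_le] allows [n ^ j + 1] values for each end of the window. *)
have cX : (#|X| <= 12 * j * n ^ (3 * j))%N.
  rewrite !cardsX !cardsT card_prod !card_ord.
  have Nn : (N <= 2 * n ^ j)%N by rewrite /N mul2n -addnn -addn1 leq_add2l expn_gt0 n0.
  apply: (@leq_trans ((2 * n ^ j) * (2 * n ^ j) * (j * n ^ j) * 3)).
    by rewrite !leq_mul // card_small_sets.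
  by rewrite !mulSn !expnD; apply: eq_leq; ring.
apply: le_trans (_ : _ <= #|X|%:R * expR (- S)) _; last first.
  by apply: ler_wpM2r; rewrite ?expR_ge0 // ler_nat.
apply: (@hgprob_union _ _ _ _ _ _ X _ bad p01); last first.
  by move=> y _; apply: window_tail.
move=> H _ /andP[i_stop fail].
case: (boolP [exists y in X, bad y H]) => [/existsP[y /andP[yX yb]]|].
  by exists y.
rewrite negb_exists => /forallP good; exfalso; move/negP: fail; apply.
pose f := i.-1; have fN : (f < N)%N.
  by rewrite /N ltnS; apply: (rounds_le sJp sKp J1j i_stop).
have iE : i = f.+1 by rewrite /f prednK.
have tail (r0 r1 : nat) (L : {set 'I_n}) (c : 'I_3) : (#|L| < j)%N -> (r1 <= f)%N ->
    let a : R := if c == 2%N :> nat then - x else x in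
    let m : rule n := if c == 0%N :> nat then pivot_rule L
      else if c == 1%N :> nat then jump_rule L else lonely_rule j in
    a * (\sum_(r0 <= t < r1) round_found k j J1 m H t)%:R
    - p * (expR a - 1) * (\sum_(r0 <= t < r1) round_asked k j J1 m H t)%:R < S.
  move=> Lj r1f /=; have [r10|r01] := leqP r1 r0.
    by rewrite !big_geq // !mulr0 subr0; exact: lt_le_trans ltr01 S1.
  have r1N : (r1 < N)%N by apply: leq_ltn_trans fN.
  have := good (Ordinal (ltn_trans r01 r1N), Ordinal r1N, L, c).
  by rewrite negb_and !inE /= Lj /= -ltNge.
rewrite iE (generation_reach H sKp sJp J1j) -/(front k j J1 H f).
apply: natr_bigmax_le.
  have Q0 : 0 <= degree_const R k j by apply: le_trans (degree_const_ge1 R jk).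
  have S0 : 0 <= S by apply: le_trans S1.
  by rewrite mulr_ge0 ?addr_ge0 ?divr_ge0 ?exprn_ge0.
move=> L; rewrite mem_rsets => /eqP cL; rewrite -cL.
have Lj : (#|L| < j)%N by rewrite cL.
have small t : (t < f)%N -> #|reach k j H J1 t.+1|%:R <= lam * n%:R ^+ j.
  move=> tf; have ti : (t.+1 < i)%N by rewrite iE ltnS.
  by have [_ /ltW] := before_stop sJp sKp J1j i_stop ti.
apply: (@front_degree_bound R n k j p e lam S H J1 f) => //.
- by case/andP: p01.
- by move=> L' r0 r1 L'j r1f; have := tail r0 r1 L' (Ordinal (isT : (0 < 3)%N)) L'j r1f.
- by move=> L' r0 r1 L'j r1f; have := tail r0 r1 L' (Ordinal (isT : (1 < 3)%N)) L'j r1f.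
(* The lonely rule does not refer to [L]; [set0] is a dummy index. *)
move=> t tf; have l0 : (#|@finset.set0 'I_n| < j)%N by rewrite cards0.
have := tail t t.+1 _ (Ordinal (isT : (2 < 3)%N)) l0 tf.
by rewrite /= !big_nat1.
Qed.

(** * Asymptotics *)

Local Open Scope classical_set_scope.
Local Open Scope ring_scope.

Lemma powR_near_ge (R : realType) (d B : R) : 0 < d ->
  \forall n \near \oo, B <= n%:R `^ d.
Proof.
move=> d0; near=> n.
have [B0|B0] := ltP B 0; first by apply: le_trans (ltW B0) (powR_ge0 _ _).
have e : B = (B `^ d^-1) `^ d by rewrite -powRrM mulVf ?powRr1 // gt_eqF.
rewrite [leLHS]e; apply: ge0_ler_powR; rewrite ?nnegrE ?powR_ge0 ?(ltW d0) //.
by near: n; apply: nbhs_infty_ger.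
Unshelve. all: by end_near.
Qed.

(** Stretched exponentials beat polynomials. *)
Lemma poly_le_expR (R : realType) (d c : R) (m : nat) : 0 < d ->
  \forall n \near \oo, c * n%:R ^+ m <= expR (n%:R `^ d).
Proof.
move=> d0.
(* A term of the exponential series whose degree in [n] is at least [m + 1]. *)
have [b hb] : exists b : nat, m.+1%:R <= d * b.+1%:R.
  exists (Num.truncn (m.+1%:R / d)); rewrite mulrC -ler_pdivrMr //.
  by apply: ltW; apply: truncnS_gt.
near=> n.
have n1 : 1 <= n%:R :> R by near: n; apply: nbhs_infty_ger.
have n0 : 0 < n%:R :> R by apply: lt_le_trans n1.
have nc : c * b.+1`!%:R <= n%:R by near: n; apply: nbhs_infty_ger.
apply: le_trans (expR_ge1Dxn b (powR_ge0 _ _)).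
apply: (@le_trans _ _ ((n%:R `^ d) ^+ b.+1 / b.+1`!%:R)); last by rewrite lerDr.
rewrite -[(_ `^ d) ^+ _]powR_mulrn ?powR_ge0 // -powRrM ler_pdivlMr ?ltr0n ?fact_gt0 //.
apply: le_trans (ler_powR n1 hb); rewrite powR_mulrn ?(ltW n0) // exprS mulrAC.
by apply: ler_wpM2r; rewrite ?exprn_ge0 ?(ltW n0).
Unshelve. all: by end_near.
Qed.

Theorem theorem3 (R : realType) (k j : nat) (delta : R) (eps lam : nat -> R)
    (hk : (2 <= k)%N) (hj1 : (1 <= j)%N) (hjk : (j <= k - 1)%N)
    (hdelta0 : 0 < delta) (hdelta6 : delta < 1 / 6)
    (heps0 : forall n, 0 < eps n) (hlam0 : forall n, 0 < lam n)
    (hlam_delta : (fun n => n%:R `^ (- (1 / 2) + delta / 2)) =o_\oo lam)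
    (hlam_j : (fun n => n%:R `^ (- (j%:R / 3))) =o_\oo lam)
    (hlam_eps : lam =o_\oo eps)
    (heps_1 : eps =o_\oo (fun _ => 1 : R)) :
  forall l : nat, (l <= j - 1)%N ->
  exists2 C : R, 0 < C &
  exists2 c : R, 0 < c &
  \forall n \near \oo,
    forall (sJ sK : seq {set 'I_n}) (J1 : {set 'I_n}) (i : nat),
      perm_eq sJ (enum (rsets n j)) ->
      perm_eq sK (enum (rsets n k)) ->
      J1 \in rsets n j ->
      (1 <= i)%N ->
      hgprob k (edge_prob k j n (eps n))
        (fun H =>
           let gen := generation j sJ sK J1 H in
           (i <= bfs_stop_time j (lam n) sJ sK J1 H)%N &&
           ~~ ((max_degree l (gen i))%:R
                 <= C * (#|gen i|%:R / n%:R ^+ l + n%:R `^ delta)))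
      <= expR (- (c * n%:R `^ (delta / 2))).
Proof.
move=> l hl.
have jk : (0 < j < k)%N.
  by rewrite hj1 /=; apply: leq_ltn_trans hjk _; rewrite subn1 prednK // ltnW.
have lj : (l < j)%N by rewrite -[j](prednK hj1) ltnS -subn1.
have Q1 := degree_const_ge1 R jk; have tau0 := gap_gt0 R jk.
have /andP[x0 _] := rate_bounds R jk.
exists (degree_const R k j ^+ l); first by rewrite exprn_gt0 // (lt_le_trans ltr01).
exists (1 / 2); first by lra.
set tau := gap R k j in tau0; set x := rate R k j in x0.
set W := small_bias R k j.
have W0 : 0 < W.
  rewrite /W /small_bias !mulr_gt0 ?exprn_gt0 ?(lt_le_trans ltr01 Q1) //.
  by rewrite ltr0n ltnW.
have x8W : 0 < x / (16 * W) by rewrite divr_gt0 // mulr_gt0.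
have d0 : 0 < delta / 2 by lra.
have eps_small y : 0 < y -> \forall n \near \oo, eps n <= y.
  move=> y0; have := (eqoP _ _ _).1 heps_1 y y0; apply: filterS => n.
  by rewrite normr1 mulr1 ger0_norm // ltW.
have lam_le : \forall n \near \oo, lam n <= eps n.
  have := (eqoP _ _ _).1 hlam_eps 1 ltr01; apply: filterS => n.
  by rewrite mul1r !ger0_norm // ltW.
near=> n => sJ sK J1 i sJp sKp J1j i1.
have n1 : 1 <= n%:R :> R by near: n; apply: nbhs_infty_ger.
have n0 : 0 < n%:R :> R by apply: lt_le_trans n1.
have kn : (k < n)%N by near: n; apply: nbhs_infty_ge.
have S1 : 1 <= n%:R `^ (delta / 2) by near: n; apply: powR_near_ge.
have Sg : 512 / tau ^+ 3 <= n%:R `^ (delta / 2) by near: n; apply: powR_near_ge.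
have S_bias : 4 * W * (2 + noise_const R k j) / x <= n%:R `^ (delta / 2).
  by near: n; apply: powR_near_ge.
have nb : 2 * (j * (k - j))%:R / x <= n%:R by near: n; apply: nbhs_infty_ger.
have e_small : eps n <= tau / 8.
  by near: n; apply: eps_small; rewrite divr_gt0.
have lam_small : lam n <= x / (16 * W).
  apply: (@le_trans _ _ (eps n)); first by near: n.
  by near: n; apply: eps_small.
have poly' : (12 * j)%:R * n%:R ^+ (3 * j) <= expR (n%:R `^ (delta / 4)).
  by near: n; apply: poly_le_expR; rewrite divr_gt0.
have r2 : 2 <= n%:R `^ (delta / 4) by near: n; apply: powR_near_ge; rewrite divr_gt0.
set S := n%:R `^ (delta / 2) in S1 Sg S_bias *.
have S0 : 0 < S by apply: lt_le_trans S1.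
have Spow m : S ^+ m = n%:R `^ (delta / 2 * m%:R).
  by rewrite powRrM powR_mulrn // powR_ge0.
(* With [S = n `^ (delta / 2)], [S ^+ 2] is the additive term of the bound, and
   [S ^+ 3 <= n] makes [n `^ delta / n] small. *)
have S2 : n%:R `^ delta = S ^+ 2 by rewrite Spow divfK.
have S3 : S ^+ 3 <= n%:R.
  by rewrite Spow -[leRHS]powRr1 ?(ltW n0) // ler_powR //; lra.
have poly : (12 * j)%:R * n%:R ^+ (3 * j) <= expR (S / 2).
  apply: le_trans poly' _; rewrite ler_expR ler_pdivlMr //.
  rewrite /S (_ : delta / 2 = delta / 4 * 2%:R); last by field.
  rewrite [leRHS]powRrM powR_mulrn ?powR_ge0 // expr2.
  by apply: ler_wpM2l; rewrite ?powR_ge0.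
rewrite S2; apply: le_trans (generation_tail _ _ _ _ _ _ _ _ _ _ _ _ _ _) _ => //.
- exact: ltW.
- have h1 : W * (4 * lam n) <= x / 4.
    have W16 : 0 < 16 * W by apply: mulr_gt0.
    by move: lam_small; rewrite ler_pdivlMr // => h; lra.
  have h2 : W * ((2 + noise_const R k j) / S) <= x / 4.
    move: S_bias; rewrite ler_pdivrMr // mulrA ler_pdivrMr // => h; lra.
  by rewrite -/W -/x mulrDr; lra.
- rewrite ler_pdivrMr //; move: nb; rewrite ler_pdivrMr // -/x => h; lra.
rewrite natrM natrX.
have -> : expR (- (1 / 2 * S)) = expR (S / 2) * expR (- S).
  by rewrite -expRD; congr expR; field.
by apply: ler_wpM2r; rewrite ?expR_ge0.
Unshelve. all: by end_near.
Qed.
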